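(* Let $p\in(0,1)$ and $b\in(0,1)$ be fixed, let $q:(0,\infty)\to(0,1)$ be the function such that, for each $a>0$, $q(a)$ is the unique element of $(0,1)$ satisfying $$\int_0^{q(a)} t^{a-1}(1-t)^{b-1}\,dt = p\int_0^1 t^{a-1}(1-t)^{b-1}\,dt ,$$ and let $\phi(a):=-a\log q(a)$ for $a>0$. Then $\phi$ is strictly convex on $(0,\infty)$.
   Context: The value $q(a)$ is the $p$-quantile of the beta distribution with parameters $a,b$ (the inverse regularised incomplete beta function), regarded as a function of the first parameter $a$ with $p$ and $b$ fixed. *)

(* Defs.v *)
From HB Require Import structures.
From mathcomp Require Import all_boot all_order all_algebra.
From mathcomp Require Import all_classical all_reals all_analysis.

Set Implicit Arguments.
Unset Strict Implicit.
Unset Printing Implicit Defensive.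

Import Order.TTheory GRing.Theory Num.Theory.
Import numFieldNormedType.Exports.

Local Open Scope classical_set_scope.
Local Open Scope ring_scope.

(* The Lebesgue integral of t^(a-1) (1-t)^(b-1) over ]0, x[, finite when
   a, b > 0 and 0 <= x <= 1.  The open interval keeps the conventional values
   of [powR] at base 0 out of the integrand. *)
Definition inc_beta (R : realType) (a b x : R) : \bar R :=
  (\int[lebesgue_measure]_(t in `]0%R, x[)
     (t `^ (a - 1) * (1 - t) `^ (b - 1))%:E)%E.

Definition is_beta_quantile (R : realType) (p a b x : R) : Prop :=
  0 < x < 1 /\ inc_beta a b x = (p%:E * inc_beta a b 1)%E.

Definition strictly_convex_on (R : realType) (D : set R) (f : R -> R) : Prop :=
  forall x y t : R, D x -> D y -> x != y -> 0 < t < 1 ->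
    f (t * x + (1 - t) * y) < t * f x + (1 - t) * f y.

(* Main.v *)
Require Import Defs.
From HB Require Import structures.
From mathcomp Require Import all_boot all_order all_algebra.
From mathcomp Require Import all_classical all_reals all_analysis.
From mathcomp Require Import measurable_realfun.
From mathcomp Require Import ring lra.

(** Put [l a = - a * ln (q a)], so that [q a = expR (- l a / a)].  In the
coordinate [t = q a * expR (v / a)] the beta density becomes, up to a constant
factor, the function
[g_a v = expR v * ((1 - q a * expR (v / a)) / (1 - q a)) `^ (b - 1)] on
[v < l a], the quantile sits at [v = 0], and [g_a 0 = 1].

Differentiating the quantile equation in [a] gives
[a ^+ 2 * q' a / q a = S a], where
[S a = p * \int_(0 < v < l a) v * g_a v + (1 - p) * \int_(v < 0) (- v) * g_a v]
([is_derive_quantile], [quantile_log_moment]).  As a function of [1 / a], the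
number [- ln (q a)] therefore has derivative [S a].  If [S] is strictly
decreasing in [a], then [- ln (q a)] is strictly convex in [1 / a], and so
[l a = a * (- ln (q a))] is strictly convex in [a]: explicitly, for every
[s] the function [x |-> - ln (q x) - S s / x] has a strict minimum at [s],
which puts [l] strictly above its tangent line at [s].

It remains to compare [S] at [a0 < a1] ([log_moment_lt]).  Everything rests on
one elementary fact ([one_sub_expR_ratio_lt]): for [s < S] the quotient
[(1 - expR (- S / a)) / (1 - expR (- s / a))] increases with [a].  Since
[b - 1 < 0], raising to the power [b - 1] reverses inequalities, and this has
two consequences.
- The two densities, in the coordinate [t = expR (v / a)], have a monotone
  likelihood ratio, whence [l a1 <= l a0] ([scaled_log_quantile_le]).
- Then [g_a1 < g_a0] for [v < 0], while [g_a0 <= g_a1] for [0 < v < l a1].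

The first moments are now compared by the equation
[(1 - p) * \int_(v < 0) g_a = p * \int_(0 < v < l a) g_a].  Below [0] the
function [g_a0] has the larger mass, hence also above [0]; but between [0] and
[l a1] it is the smaller of the two, so its excess of mass lies beyond [l a1],
where it only helps the first moment ([first_moment_lt]). *)

Set Implicit Arguments.
Unset Strict Implicit.
Unset Printing Implicit Defensive.

Import Order.TTheory GRing.Theory Num.Theory.
Import numFieldNormedType.Exports.

Local Open Scope classical_set_scope.
Local Open Scope ring_scope.

(** * An inequality for exponentials *)

(** By the mean value theorem the chords of [t `^ l] over [y, x] and over
[x, 1] have slopes that are values of its derivative, which increases because
[1 < l]. *)
Lemma powR_chord_lt (R : realType) (l x y : R) :
  1 < l -> 0 < y -> y < x -> x < 1 ->
  (1 - y `^ l) * (1 - x) < (1 - x `^ l) * (1 - y).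
Proof.
move=> l1 y0 yx x1.
have l0 : 0 < l by lra.
have mvt (u v : R) : 0 < u -> u < v ->
    exists2 c, c \in `]u, v[ & v `^ l - u `^ l = l * c `^ (l - 1) * (v - u).
  move=> u0 uv; apply: (@MVT _ (fun t => t `^ l) (fun t => l * t `^ (l - 1))) => //.
  - move=> t; rewrite in_itv/= => /andP[ut _].
    have t0 : t \in `]0, +oo[ by rewrite in_itv/= andbT (lt_trans u0).
    split; first exact: derivable_powR.
    by rewrite -derive1E powR_derive1.
  - apply: derivable_within_continuous => t; rewrite in_itv/= => /andP[ut _].
    by apply: derivable_powR; rewrite in_itv/= andbT (lt_le_trans u0).
have [c1] := mvt _ _ y0 yx; rewrite in_itv/= => /andP[yc1 c1x] e1.
have [c2] := mvt _ _ (lt_trans y0 yx) x1; rewrite in_itv/= => /andP[xc2 c21].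
rewrite powR1 => e2.
have c12 : l * c1 `^ (l - 1) < l * c2 `^ (l - 1).
  by rewrite ltr_pM2l// gt0_ltr_powR// ?nnegrE; lra.
move: e1 e2 c12; move: (l * c1 `^ _) (l * c2 `^ _) => s1 s2 e1 e2 s12.
have -> : 1 - y `^ l = s2 * (1 - x) + s1 * (x - y) by lra.
rewrite e2 -subr_gt0.
have -> : s2 * (1 - x) * (1 - y) - (s2 * (1 - x) + s1 * (x - y)) * (1 - x) =
  (s2 - s1) * (x - y) * (1 - x) by ring.
by rewrite !mulr_gt0// subr_gt0.
Qed.

(** With [y = expR (- s / a0)], [x = expR (- s / a1)] and exponent [S / s] this
is the comparison of chords [powR_chord_lt]; it says that
[(1 - expR (- S / a)) / (1 - expR (- s / a))] increases with [a]. *)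
Lemma one_sub_expR_ratio_lt (R : realType) (s S a0 a1 : R) :
  0 < s -> s < S -> 0 < a0 -> a0 < a1 ->
  (1 - expR (- S / a0)) * (1 - expR (- s / a1)) <
  (1 - expR (- S / a1)) * (1 - expR (- s / a0)).
Proof.
move=> s0 sS a00 a01.
have a10 : 0 < a1 by lra.
have e (a : R) : 0 < a -> expR (- S / a) = expR (- s / a) `^ (S / s).
  move=> a_gt0; rewrite -expRM; congr expR; field.
  by rewrite !gt_eqF.
rewrite !e//; apply: powR_chord_lt.
- by rewrite ltr_pdivlMr// mul1r.
- exact: expR_gt0.
- rewrite ltr_expR !mulNr ltrN2 ltr_pM2l// ltf_pV2//.
- by rewrite expR_lt1 mulNr oppr_lt0 divr_gt0.
Qed.

(** * Comparison of first moments *)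

Lemma Rintegral_gt0 d (T : measurableType d) (R : realType)
  (mu : {measure set T -> \bar R}) (D : set T) (f : T -> R) :
  measurable D -> (mu D != 0)%E -> mu.-integrable D (EFin \o f) ->
  (forall x, D x -> 0 < f x) -> 0 < \int[mu]_(x in D) f x.
Proof.
move=> mD muD intf f0.
rewrite lt_neqAle Rintegral_ge0 ?andbT; last by move=> x /f0/ltW.
apply/negP => /eqP If0; move/negP: muD; apply.
have If : (\int[mu]_(x in D) (f x)%:E = 0)%E.
  have := integrable_fin_num mD intf => /fineK <-; by rewrite -/(Rintegral mu D f) -If0.
have : (\int[mu]_(x in D) `|(EFin \o f) x| = 0)%E.
  rewrite -[RHS]If; apply: eq_integral => x /set_mem/f0 fx /=.
  by rewrite gtr0_norm.
move/ae_eq_integral_abs => /(_ mD) [|N [mN N0 DN]].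
  by case/integrableP: intf.
apply/eqP/(subset_measure0 mD mN _ N0) => x Dx; apply: DN => /= /(_ Dx) [fx0].
by have := f0 _ Dx; rewrite fx0 ltxx.
Qed.

Local Notation mu := lebesgue_measure.

Lemma integrable_EFinB d (T : measurableType d) (R : realType)
    (m : {measure set T -> \bar R}) (D : set T) (f g : T -> R) :
  measurable D -> m.-integrable D (EFin \o f) -> m.-integrable D (EFin \o g) ->
  m.-integrable D (EFin \o (fun x => f x - g x)).
Proof. by move=> mD jf jg; exact: (integrableB mD jf jg). Qed.

Lemma integrable_EFinZl d (T : measurableType d) (R : realType)
    (m : {measure set T -> \bar R}) (D : set T) (k : R) (f : T -> R) :
  measurable D -> m.-integrable D (EFin \o f) ->
  m.-integrable D (EFin \o (fun x => k * f x)).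
Proof. by move=> mD jf; exact: (integrableZl mD k jf). Qed.

(** The mass of [g0] exceeds that of [g1] below [0], hence, the proportions
being fixed by [p], also above [0].  Above [0] the weight [v - l1] is negative
only where [g0 <= g1], so that
[\int (v - l1) * g0 >= \int (v - l1) * g1]; adding [l1] times the excess of
mass compares the first moments on this side.  The strictness comes from the
other side, where [- v * g1 v < - v * g0 v]. *)
Lemma first_moment_lt (R : realType) (p l0 l1 : R) (g0 g1 : R -> R) :
  0 < p < 1 -> l1 <= l0 ->
  mu.-integrable `]-oo, 0[ (EFin \o g0) ->
  mu.-integrable `]-oo, 0[ (EFin \o g1) ->
  mu.-integrable `]-oo, 0[ (EFin \o (fun v => - v * g0 v)) ->
  mu.-integrable `]-oo, 0[ (EFin \o (fun v => - v * g1 v)) ->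
  mu.-integrable `]0, l0[ (EFin \o g0) ->
  mu.-integrable `]0, l1[ (EFin \o g1) ->
  mu.-integrable `]0, l0[ (EFin \o (fun v => v * g0 v)) ->
  mu.-integrable `]0, l1[ (EFin \o (fun v => v * g1 v)) ->
  (1 - p) * \int[mu]_(v in `]-oo, 0[) g0 v = p * \int[mu]_(v in `]0, l0[) g0 v ->
  (1 - p) * \int[mu]_(v in `]-oo, 0[) g1 v = p * \int[mu]_(v in `]0, l1[) g1 v ->
  (forall v, v < 0 -> g1 v < g0 v) ->
  (forall v, 0 < v < l1 -> g0 v <= g1 v) ->
  (forall v, 0 < v < l0 -> 0 <= g0 v) -> 0 < l1 ->
  p * \int[mu]_(v in `]0, l1[) (v * g1 v) +
    (1 - p) * \int[mu]_(v in `]-oo, 0[) (- v * g1 v) <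
  p * \int[mu]_(v in `]0, l0[) (v * g0 v) +
    (1 - p) * \int[mu]_(v in `]-oo, 0[) (- v * g0 v).
Proof.
move=> /andP[p0 p1] l10 i0 i1 m0 m1 j0 j1 n0 n1 e0 e1 glt gle gge l1_gt0.
have muN : (mu `]-oo, (0 : R)%R[%classic != 0)%E by rewrite lebesgue_measure_itv/= ltNyr.
have below : \int[mu]_(v in `]-oo, 0[) g1 v < \int[mu]_(v in `]-oo, 0[) g0 v.
  rewrite -subr_gt0 -RintegralB//; apply: Rintegral_gt0 => //.
    exact: integrable_EFinB.
  by move=> v; rewrite /= in_itv/= => /glt; rewrite subr_gt0.
have mbelow : \int[mu]_(v in `]-oo, 0[) (- v * g1 v) <
    \int[mu]_(v in `]-oo, 0[) (- v * g0 v).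
  rewrite -subr_gt0 -RintegralB//; apply: Rintegral_gt0 => //.
    exact: integrable_EFinB.
  move=> v; rewrite /= in_itv/= => v0; rewrite -mulrBr mulr_gt0// ?oppr_gt0//.
  by rewrite subr_gt0 glt.
have sub10 : `]0, l1[ `<=` `]0, l0[.
  by move=> v; rewrite /= !in_itv/= => /andP[-> /lt_le_trans]; exact.
have shift (l : R) (g : R -> R) :
    mu.-integrable `]0, l[ (EFin \o g) ->
    mu.-integrable `]0, l[ (EFin \o (fun v => v * g v)) ->
    mu.-integrable `]0, l[ (EFin \o (fun v => v * g v - l1 * g v)) /\
    \int[mu]_(v in `]0, l[) (v * g v) - l1 * \int[mu]_(v in `]0, l[) g v =
    \int[mu]_(v in `]0, l[) (v * g v - l1 * g v).
  move=> ig ivg.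
  have il : mu.-integrable `]0, l[ (EFin \o (fun v => l1 * g v)).
    exact: integrable_EFinZl.
  rewrite RintegralB// RintegralZl//; split => //.
  exact: integrable_EFinB.
have [k0 s0] := shift _ _ j0 n0.
have [k1 s1] := shift _ _ j1 n1.
have k01 : mu.-integrable `]0, l1[ (EFin \o (fun v => v * g0 v - l1 * g0 v)).
  exact: integrableS k0.
(* The weight [v - l1] is nonnegative beyond [l1], so the part of the integral
   of [g0] over [l1, l0[ may be dropped. *)
have above : \int[mu]_(v in `]0, l1[) (v * g1 v - l1 * g1 v) <=
    \int[mu]_(v in `]0, l0[) (v * g0 v - l1 * g0 v).
  apply: (@le_trans _ _ (\int[mu]_(v in `]0, l1[) (v * g0 v - l1 * g0 v))).
    apply: le_Rintegral => // v; rewrite /= in_itv/= => /andP[v0 vl].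
    have := gle v; rewrite v0 vl => /(_ isT) g01.
    by rewrite -!mulrBl ler_wnM2l// subr_le0 ltW.
  have e : `]0, l0[%classic = `]0, l1[%classic `|` `[l1, l0[%classic :> set R.
    apply/seteqP; split => v; rewrite /= !in_itv/=.
      by move=> /andP[-> ->]; case: (ltP v l1) => ?; [left|right].
    by move=> [/andP[-> /lt_le_trans]|/andP[lv ->]]; [exact|rewrite andbT (lt_le_trans l1_gt0)].
  rewrite e Rintegral_setU//=; [|by rewrite -e|]; last first.
    apply/disj_setPRL => v /=; rewrite !in_itv/= => /andP[lv _] /andP[_].
    by rewrite ltNge lv.
  rewrite lerDl; apply: Rintegral_ge0 => v; rewrite /= in_itv/= => /andP[lv vl].
  rewrite -mulrBl mulr_ge0 ?subr_ge0//.
  by rewrite gge// vl andbT (lt_le_trans l1_gt0).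
move: above below mbelow; rewrite -s0 -s1.
move: e0 e1.
move: (\int[mu]_(v in `]0, l0[) g0 v) (\int[mu]_(v in `]0, l1[) g1 v) => G0 G1.
move: (\int[mu]_(v in `]-oo, 0[) g0 v) (\int[mu]_(v in `]-oo, 0[) g1 v) => A0 A1.
move: (\int[mu]_(v in `]0, l0[) (v * g0 v)) => M0.
move: (\int[mu]_(v in `]0, l1[) (v * g1 v)) => M1.
move: (\int[mu]_(v in `]-oo, 0[) (- v * g0 v)) => N0.
move: (\int[mu]_(v in `]-oo, 0[) (- v * g1 v)) => N1.
move=> e0 e1 M10 A10 N10.
clear - p0 p1 l1_gt0 e0 e1 M10 A10 N10.
have pG : 0 <= p * (G0 - G1) by rewrite mulrBr -e0 -e1; nra.
have G10 : G1 <= G0 by move: pG; rewrite pmulr_rge0// subr_ge0.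
have lG : 0 <= l1 * (G0 - G1) by rewrite mulr_ge0 ?subr_ge0// ltW.
have pM : p * M1 <= p * M0 by rewrite ler_pM2l//; lra.
have pN : (1 - p) * N1 < (1 - p) * N0 by rewrite ltr_pM2l// subr_gt0.
lra.
Qed.

(** * Exponential change of variables on open intervals *)

Lemma ge0_cvg_integral_itvcc (R : realType) (H : R -> R) (x y : nat -> R) :
  nonincreasing_seq x -> nondecreasing_seq y ->
  (forall n t, t \in `[x n, y n] -> 0 <= H t) ->
  (forall n t, t \in `[x n, y n] -> {for t, continuous H}) ->
  (\int[mu]_(t in `[x n, y n]) (H t)%:E)%E @[n --> \oo] -->
  (\int[mu]_(t in \bigcup_n `[x n, y n]%classic) (H t)%:E)%E.
Proof.
move=> nx ny H0 cH; apply: ge0_nondecreasing_set_cvg_integral => //.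
- move=> m n mn; apply/subsetPset => t /=; rewrite !in_itv/= => /andP[xt ty].
  by rewrite (le_trans _ xt) ?nx//= (le_trans ty)// ny.
- move=> n; apply/measurable_EFinP; apply: subspace_continuous_measurable_fun => //.
  by apply: continuous_in_subspaceT => t /set_mem; exact: cH.
Qed.

(** Substitution is known on segments for continuous integrands; for a
nonnegative integrand both sides pass to the increasing limit.  This reaches
open and unbounded intervals where the integrand blows up at the ends. *)
Lemma ge0_integration_by_substitution_bigcup (R : realType) (F G : R -> R)
    (u v : nat -> R) :
  {homo F : x y / x < y} -> (forall x, derivable F x 1) -> continuous (derive1 F) ->
  (forall n, u n <= v n) -> nonincreasing_seq u -> nondecreasing_seq v ->
  (forall n x, x \in `[F (u n), F (v n)] -> 0 <= G x) ->
  (forall n x, x \in `[F (u n), F (v n)] -> {for x, continuous G}) ->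
  (\int[mu]_(x in \bigcup_n `[F (u n), F (v n)]%classic) (G x)%:E =
   \int[mu]_(x in \bigcup_n `[u n, v n]%classic) (G (F x) * derive1 F x)%:E)%E.
Proof.
move=> Finc dF cF' uv nu nv G0 cG.
have Fle : {homo F : x y / x <= y} by exact: ltW_homo.
have cF : continuous F by move=> x; exact/differentiable_continuous/derivable1_diffP.
have F'0 x : 0 <= derive1 F x.
  rewrite derive1E; apply: limr_ge; first exact: dF.
  near=> h; have h0 : h != 0 by near: h; exact: nbhs_dnbhs_neq.
  rewrite scaler1; have [h_gt0|] := ltP 0 h.
    by rewrite mulr_ge0 ?invr_ge0 ?subr_ge0 ?Fle ?lerDr// ltW.
  by move=> h_le0; rewrite mulr_le0 ?invr_le0 ?subr_le0 ?Fle// gerDr.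
have subF n x : x \in `[u n, v n] -> F x \in `[F (u n), F (v n)].
  by rewrite !in_itv/= => /andP[ux xv]; rewrite !Fle.
have cGF n x : x \in `[u n, v n] -> {for x, continuous (fun x => G (F x) * derive1 F x)}.
  move=> xuv; apply: cvgM; last exact: cF'.
  by apply: continuous_comp; [exact: cF|exact/cG/subF/xuv].
have e n : (\int[mu]_(x in `[F (u n), F (v n)]) (G x)%:E =
            \int[mu]_(x in `[u n, v n]) (G (F x) * derive1 F x)%:E)%E.
  rewrite (@integration_by_substitution_increasing R F G (u n) (v n))//.
  - by move=> x y _ _; exact: Finc.
  - apply/cvg_ex; exists (derive1 F (u n)); by apply: cvg_at_right_filter; exact: cF'.
  - apply/cvg_ex; exists (derive1 F (v n)); by apply: cvg_at_left_filter; exact: cF'.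
  - by split => //; [apply: cvg_at_right_filter; exact: cF|apply: cvg_at_left_filter; exact: cF].
  - by apply: continuous_in_subspaceT => x /set_mem; exact: cG.
have L1 := @ge0_cvg_integral_itvcc R G (F \o u) (F \o v)
  (fun m n mn => Fle _ _ (nu m n mn)) (fun m n mn => Fle _ _ (nv m n mn)) G0 cG.
have L2 := @ge0_cvg_integral_itvcc R _ _ _ nu nv
  (fun n t tuv => mulr_ge0 (G0 n _ (subF n t tuv)) (F'0 t)) cGF.
move: L2; rewrite -(funext e) => L2.
exact: cvg_unique L1 L2.
Unshelve. all: by end_near. Qed.

Lemma itvNyo_bigcup_itvcc (R : realType) (m : R) :
  `]-oo, m[%classic = \bigcup_k `[m - k%:R - 1, m - k.+1%:R^-1]%classic.
Proof.
apply/seteqP; split => [x|x [k _]]; rewrite /= !in_itv/=; last first.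
  by move=> /andP[_] /le_lt_trans; apply; rewrite gtrBl invr_gt0.
rewrite -subr_gt0 => mx.
near \oo => k; exists k => //=; rewrite in_itv/=; apply/andP; split.
- have : m - x <= k%:R by near: k; exact: nbhs_infty_ger.
  by move=> h; lra.
- rewrite lerBrDl -lerBrDr ltW//; near: k.
  exact: near_infty_natSinv_lt (PosNum mx).
Unshelve. all: by end_near. Qed.

Lemma itvoo_bigcup_itvcc (R : realType) (m n : R) : m < n ->
  `]m, n[%classic =
  \bigcup_k `[m + (n - m) * k.+2%:R^-1, n - (n - m) * k.+2%:R^-1]%classic.
Proof.
move=> mn; have nm0 : 0 < n - m by rewrite subr_gt0.
apply/seteqP; split => [x|x [k _]]; rewrite /= !in_itv/=; last first.
  move=> /andP[xl xr]; rewrite (lt_le_trans _ xl) ?(le_lt_trans xr)//.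
    by rewrite gtrBl mulr_gt0.
  by rewrite ltrDl mulr_gt0.
move=> /andP[mx xn].
have e1 : 0 < (x - m) / (n - m) by rewrite divr_gt0// subr_gt0.
have e2 : 0 < (n - x) / (n - m) by rewrite divr_gt0// subr_gt0.
have le2 (k : nat) : (k.+2%:R^-1 : R) <= k.+1%:R^-1.
  by rewrite lef_pV2 ?posrE// ler_nat.
near \oo => k; exists k => //=; rewrite in_itv/= ; apply/andP; split.
- rewrite -lerBrDl mulrC -ler_pdivlMr// (le_trans (le2 _))// ltW//.
  near: k; exact: near_infty_natSinv_lt (PosNum e1).
- rewrite lerBrDl -lerBrDr mulrC -ler_pdivlMr// (le_trans (le2 _))// ltW//.
  near: k; exact: near_infty_natSinv_lt (PosNum e2).
Unshelve. all: by end_near. Qed.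

(** The sets [I] and [J] are related by a membership equivalence rather than by
an equation between images: every [t > 0] is [z * expR (s / a)] for one [s],
so the equivalence already determines [J]. *)
Lemma ge0_integration_by_substitution_expR (R : realType) (z a : R)
    (G : R -> R) (I J : set R) (u v : nat -> R) :
  0 < z -> 0 < a -> (forall n, u n <= v n) ->
  nonincreasing_seq u -> nondecreasing_seq v ->
  I = \bigcup_n `[u n, v n]%classic ->
  J `<=` `]0, +oo[ -> (forall s, J (z * expR (s / a)) <-> I s) ->
  (forall t, J t -> 0 <= G t) -> (forall t, J t -> {for t, continuous G}) ->
  (\int[mu]_(t in J) (G t)%:E =
   \int[mu]_(s in I) (G (z * expR (s / a)) * (z * expR (s / a) / a))%:E)%E.
Proof.
move=> z0 a0 uv nu nv eI J0 JI G0 cG.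
pose F s := z * expR (s / a).
have dF (s : R) : is_derive s 1 F (F s / a).
  rewrite /F; apply: is_derive_eq.
  by rewrite /GRing.scale/= mulr0 add0r; ring.
have F' : derive1 F = (fun s => F s / a).
  by apply/funext => s; rewrite derive1E derive_val.
have Fmono : {mono F : x y / x <= y}.
  by move=> x y; rewrite /F ler_pM2l// ler_expR ler_pM2r// invr_gt0.
have Fsur (t : R) : 0 < t -> exists s, t = F s.
  move=> t0; exists (a * ln (t / z)); rewrite /F mulrAC divff ?gt_eqF// mul1r.
  by rewrite lnK ?posrE ?divr_gt0// mulrCA divff ?gt_eqF// mulr1.
have eJ : J = \bigcup_n `[F (u n), F (v n)]%classic.
  apply/seteqP; split => [t Jt|t [n _]].
    have t0 : 0 < t by have := J0 _ Jt; rewrite /= in_itv/= andbT.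
    have [s tE] := Fsur _ t0; move: Jt; rewrite tE => /JI; rewrite eI => -[n _].
    by rewrite /= in_itv/= => /andP[us sv]; exists n; rewrite //= in_itv/= !Fmono us.
  rewrite /= in_itv/= => /andP[ut tv].
  have t0 : 0 < t by rewrite (lt_le_trans _ ut)// /F mulr_gt0// expR_gt0.
  have [s tE] := Fsur _ t0; rewrite tE; apply/JI; rewrite eI.
  by exists n; rewrite //= in_itv/= -(Fmono (u n)) -(Fmono s) -tE ut tv.
have := @ge0_integration_by_substitution_bigcup R F G u v.
rewrite -eJ -eI F' => ->//.
- by move=> x y xy; rewrite lt_neqAle Fmono (ltW xy) andbT; apply: contraTneq xy => /(inc_inj Fmono)->; rewrite ltxx.
- move=> s; apply: cvgMl; apply/differentiable_continuous/derivable1_diffP.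
  by have [] := dF s.
- by move=> n t tn; apply: G0; rewrite eJ; exists n.
- by move=> n t tn; apply: cG; rewrite eJ; exists n.
Qed.

(** * Integrability of the beta density *)

Lemma continuous_measurable_fun_itvoo (R : realType) (i : interval R) (f : R -> R) :
  open [set` i] -> (forall t, t \in i -> {for t, continuous f}) ->
  measurable_fun [set` i] f.
Proof.
move=> oi cf; apply: open_continuous_measurable_fun => //.
by move=> t /set_mem; exact: cf.
Qed.

(** The integrals over the segments inside the interval are increments of [P],
hence at most [M], and they increase to the integral over the interval. *)
Lemma integrable_bounded_primitive (R : realType) (f P : R -> R) (m n M : R) :
  m < n -> (forall t, t \in `]m, n[ -> is_derive t 1 P (f t)) ->
  (forall t, t \in `]m, n[ -> {for t, continuous f}) ->
  (forall t, t \in `]m, n[ -> 0 <= f t) ->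
  (forall t, t \in `]m, n[ -> 0 <= P t <= M) ->
  mu.-integrable `]m, n[ (EFin \o f).
Proof.
move=> mn dP cf f0 PM.
have mf : measurable_fun `]m, n[ f by exact: continuous_measurable_fun_itvoo.
apply/integrableP; split; first exact/measurable_EFinP.
under eq_integral => t /set_mem mtn do rewrite /= ger0_norm ?f0//.
have nm0 : 0 < n - m by rewrite subr_gt0.
pose u k : R := m + (n - m) * k.+2%:R^-1.
pose v k : R := n - (n - m) * k.+2%:R^-1.
have nu : nonincreasing_seq u.
  by move=> i j ij; rewrite lerD2l ler_pM2l// lef_pV2 ?posrE// ler_nat !ltnS.
have nv : nondecreasing_seq v.
  by move=> i j ij; rewrite lerD2l lerN2 ler_pM2l// lef_pV2 ?posrE// ler_nat !ltnS.
have uvmn k t : t \in `[u k, v k] -> t \in `]m, n[.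
  move=> tk; suff : (`]m, n[%classic) t by [].
  by rewrite (@itvoo_bigcup_itvcc R _ _ mn); exists k.
have uv k : u k <= v k.
  rewrite /u /v lerBrDr -addrA -mulrDr -lerBrDl ler_piMr ?(ltW nm0)//.
  have : (k.+2%:R^-1 : R) <= 2^-1 by rewrite lef_pV2 ?posrE// ler_nat.
  by move: (k.+2%:R^-1) => x h; rewrite -[leRHS](@mulVf R 2)// mulr2n mulrDr mulr1 lerD.
have := @ge0_cvg_integral_itvcc R f u v nu nv (fun k t tk => f0 t (uvmn k t tk))
  (fun k t tk => cf t (uvmn k t tk)).
rewrite -(@itvoo_bigcup_itvcc R _ _ mn) => L.
apply: (@le_lt_trans _ _ M%:E); last exact: ltry.
rewrite -(cvg_lim _ L)//; apply: lime_le; first by apply/cvg_ex; eexists; exact: L.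
apply: nearW => k.
have [uvk|uvk] := eqVneq (u k) (v k).
  rewrite uvk set_itv1 integral_set1 lee_fin.
  have mid : (m + n) / 2 \in `]m, n[ by rewrite in_itv/=; apply/andP; split; lra.
  by have /andP[+ /(le_trans _)] := PM _ mid => /[swap]; apply.
have uvlt : u k < v k by rewrite lt_neqAle uvk uv.
have cP t : t \in `]m, n[ -> {for t, continuous P}.
  by move=> /dP [dPt _]; exact/differentiable_continuous/derivable1_diffP.
have uk : u k \in `[u k, v k] by rewrite in_itv/= lexx uv.
have vk : v k \in `[u k, v k] by rewrite in_itv/= lexx uv.
rewrite (@continuous_FTC2 _ f P)//.
- rewrite -EFinB lee_fin.
  have /andP[_ Pv] := PM _ (uvmn _ _ vk); have /andP[Pu _] := PM _ (uvmn _ _ uk).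
  by rewrite lerBlDr (le_trans Pv)// lerDl.
- by apply: continuous_in_subspaceT => t /set_mem/uvmn; exact: cf.
- split.
  + by move=> t tuv; have [] := dP t (uvmn _ _ (subset_itv_oo_cc tuv)).
  + by apply: cvg_at_right_filter; exact/cP/uvmn/uk.
  + by apply: cvg_at_left_filter; exact/cP/uvmn/vk.
- move=> t tuv; rewrite derive1E.
  by have /@derive_val := dP t (uvmn _ _ (subset_itv_oo_cc tuv)).
Qed.

Definition beta_kernel (R : realType) (a b t : R) : R := t `^ (a - 1) * (1 - t) `^ (b - 1).

Lemma beta_kernel_gt0 (R : realType) (a b t : R) : 0 < t < 1 -> 0 < beta_kernel a b t.
Proof. by move=> /andP[t0 t1]; rewrite mulr_gt0// powR_gt0// subr_gt0. Qed.

Lemma continuous_powR (R : realType) (r t : R) : 0 < t ->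
  {for t, continuous (fun x : R => x `^ r)}.
Proof.
move=> t0; apply/differentiable_continuous/derivable1_diffP.
by have [] := is_derive1_powR r t0.
Qed.

Lemma is_derive_onem_powR (R : realType) (r t : R) : t < 1 ->
  is_derive t 1 (fun x => (1 - x) `^ r) (- (r * (1 - t) `^ (r - 1))).
Proof.
move=> t1; have t0 : 0 < 1 - t by rewrite subr_gt0.
have d1 : is_derive t (1 : R) (fun x : R => 1 - x) (- 1).
  by apply: is_derive_eq; rewrite add0r mul1r.
have d2 := is_derive1_powR r t0.
have := @is_derive1_comp R (fun x => x `^ r) (fun x => 1 - x) t _ _ d2 d1.
by rewrite mulrN1.
Qed.

Lemma continuous_onem_powR (R : realType) (r t : R) : t < 1 ->
  {for t, continuous (fun x : R => (1 - x) `^ r)}.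
Proof.
move=> t0; apply/differentiable_continuous/derivable1_diffP.
by have [] := is_derive_onem_powR r t0.
Qed.

Lemma continuous_beta_kernel (R : realType) (a b t : R) : 0 < t < 1 ->
  {for t, continuous (beta_kernel a b)}.
Proof.
move=> /andP[t0 t1].
by apply: cvgM; [exact: continuous_powR|exact: continuous_onem_powR].
Qed.

Lemma integrable_powR01 (R : realType) (a : R) : 0 < a ->
  mu.-integrable `]0, 1[ (EFin \o (fun t => t `^ (a - 1))).
Proof.
move=> a0; apply: (@integrable_bounded_primitive R _ (fun t => a^-1 * t `^ a) _ _ a^-1) => //.
- move=> t; rewrite in_itv/= => /andP[t0 _]; have d := is_derive1_powR a t0.
  by apply: is_derive_eq; rewrite /GRing.scale/= mulKf// gt_eqF.
- by move=> t; rewrite in_itv/= => /andP[t0 _]; exact: continuous_powR.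
- by move=> t _; exact: powR_ge0.
- move=> t; rewrite in_itv/= => /andP[t0 t1].
  rewrite mulr_ge0 ?powR_ge0 ?invr_ge0 ?(ltW a0)//= ler_piMr ?invr_ge0 ?(ltW a0)//.
  by rewrite -[leRHS](powRr0 t) ger_powR ?t0 ?t1 ?(ltW t1) ?(ltW a0).
Qed.

Lemma integrable_onem_powR01 (R : realType) (b : R) : 0 < b ->
  mu.-integrable `]0, 1[ (EFin \o (fun t => (1 - t) `^ (b - 1))).
Proof.
move=> b0; apply: (@integrable_bounded_primitive R _ (fun t => b^-1 * (1 - (1 - t) `^ b)) _ _ b^-1) => //.
- move=> t; rewrite in_itv/= => /andP[_ t1]; have d := is_derive_onem_powR b t1.
  by apply: is_derive_eq; rewrite /GRing.scale/= add0r mul1r opprK mulKf// gt_eqF.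
- by move=> t; rewrite in_itv/= => /andP[_ t1]; exact: continuous_onem_powR.
- by move=> t _; exact: powR_ge0.
- move=> t; rewrite in_itv/= => /andP[t0 t1].
  have h : (1 - t) `^ b <= 1.
    rewrite -[leRHS](powRr0 (1 - t)) ger_powR ?(ltW b0)//.
    by rewrite subr_gt0 t1 lerBlDr lerDl ltW.
  rewrite mulr_ge0 ?invr_ge0 ?subr_ge0 ?(ltW b0)//= ler_piMr ?invr_ge0 ?(ltW b0)//.
  by rewrite lerBlDr lerDl powR_ge0.
Qed.

Lemma powR_subr1_le2 (R : realType) (a t : R) : 0 < a -> 2^-1 <= t <= 1 ->
  t `^ (a - 1) <= 2.
Proof.
move=> a0 /andP[t2 t1]; have t0 : 0 < t by rewrite (lt_le_trans _ t2).
rewrite powRB; last by rewrite (gt_eqF t0) implybT.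
rewrite powRr1 ?(ltW t0)// ler_pdivrMr//.
apply: (@le_trans _ _ 1); last by rewrite -ler_pdivrMl// mulr1.
by rewrite -[leRHS](powRr0 t) ger_powR ?t0 ?t1  ?(ltW a0).
Qed.

(** On either half of the unit interval one of the two factors is at most [2]
by [powR_subr1_le2], which leaves an explicitly integrable power. *)
Lemma integrable_beta_kernel (R : realType) (a b : R) : 0 < a -> 0 < b ->
  mu.-integrable `]0, 1[ (EFin \o beta_kernel a b).
Proof.
move=> a0 b0.
pose g (t : R) : R := 2 * t `^ (a - 1) + 2 * (1 - t) `^ (b - 1).
have gi : mu.-integrable `]0, 1[ (EFin \o g).
  apply: (integrableD _ (integrable_EFinZl 2 _ (integrable_powR01 a0))
    (integrable_EFinZl 2 _ (integrable_onem_powR01 b0))) => //.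
apply: le_integrable gi => //.
  apply/measurable_EFinP; apply: continuous_measurable_fun_itvoo => // t.
  by rewrite in_itv/=; exact: continuous_beta_kernel.
move=> t; rewrite /= in_itv/= => t01; have /andP[t0 t1] := t01.
rewrite lee_fin gtr0_norm ?beta_kernel_gt0// ger0_norm; last first.
  by rewrite addr_ge0// mulr_ge0// powR_ge0.
rewrite /g /beta_kernel; have [t2|t2] := leP t 2^-1.
  rewrite (le_trans (y := 2 * t `^ (a - 1)))//; last first.
    by rewrite lerDl mulr_ge0// powR_ge0.
  rewrite mulrC ler_wpM2r ?powR_ge0// powR_subr1_le2//.
  by apply/andP; split; lra.
rewrite (le_trans (y := 2 * (1 - t) `^ (b - 1)))//; last first.
  by rewrite lerDr mulr_ge0// powR_ge0.
by rewrite ler_wpM2r ?powR_ge0// powR_subr1_le2// !ltW.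
Qed.

(** A logarithm costs less than half of the exponent of [t]: apply
[ln y < y] to [y = t `^ (- (a / 2))]. *)
Lemma ln_beta_kernel_le (R : realType) (a b t : R) : 0 < a -> 0 < t < 1 ->
  - ln t * beta_kernel a b t <= 2 / a * beta_kernel (a / 2) b t.
Proof.
move=> a0 /andP[t0 t1].
have e : beta_kernel (a / 2) b t = t `^ (- (a / 2)) * beta_kernel a b t.
  rewrite /beta_kernel mulrA -powRD; last by rewrite (gt_eqF t0) implybT.
  by congr (_ `^ _ * _); field.
have k0 : 0 <= beta_kernel a b t by rewrite ltW// beta_kernel_gt0// t0.
rewrite e [leRHS]mulrA ler_wpM2r//.
rewrite -ler_pdivrMl ?divr_gt0// invf_div.
have := ln_sublinear (powR_gt0 (- (a / 2)) t0); rewrite ln_powR => /ltW.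
by apply: le_trans; rewrite mulrN mulNr.
Qed.

Lemma integrable_ln_beta_kernel (R : realType) (a b : R) : 0 < a -> 0 < b ->
  mu.-integrable `]0, 1[ (EFin \o (fun t => - ln t * beta_kernel a b t)).
Proof.
move=> a0 b0; have a20 : 0 < a / 2 by rewrite divr_gt0.
have i : mu.-integrable `]0, 1[ (EFin \o (fun t => 2 / a * beta_kernel (a / 2) b t)).
  by apply: integrable_EFinZl => //; exact: integrable_beta_kernel.
apply: le_integrable i => //.
  apply/measurable_EFinP; apply: continuous_measurable_fun_itvoo => // t.
  rewrite in_itv/= => t01; have /andP[t0 t1] := t01.
  by apply: cvgM; [apply: cvgN; exact: continuous_ln|exact: continuous_beta_kernel].
move=> t; rewrite /= in_itv/= => t01.
rewrite lee_fin !ger0_norm ?ln_beta_kernel_le//.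
  by rewrite mulr_ge0 ?divr_ge0 ?(ltW a0)// ltW// beta_kernel_gt0.
by rewrite mulr_ge0 ?oppr_ge0 ?ltW ?ln_lt0 ?beta_kernel_gt0.
Qed.

(** * Derivatives of the beta mass *)

Definition beta_mass (R : realType) (a b z : R) : R :=
  \int[mu]_(t in `]0, z[) beta_kernel a b t.

Definition beta_log_mass (R : realType) (a b z : R) : R :=
  \int[mu]_(t in `]0, z[) (- ln t * beta_kernel a b t).

Lemma is_derive_powR_exponent (R : realType) (t r a : R) : 0 < t ->
  is_derive a 1 (fun x => t `^ (x - r)) (ln t * t `^ (a - r)).
Proof.
move=> t0.
have -> : (fun x => t `^ (x - r)) = (fun x => expR (ln t * (x - r))).
  by apply/funext => x; rewrite /powR gt_eqF// mulrC.
have -> : t `^ (a - r) = expR (ln t * (a - r)) by rewrite /powR gt_eqF// mulrC.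
by apply: is_derive_eq; rewrite /GRing.scale/=; ring.
Qed.

Lemma is_derive_beta_kernel (R : realType) (a b t : R) : 0 < t ->
  is_derive a 1 (fun x => beta_kernel x b t) (ln t * beta_kernel a b t).
Proof.
move=> t0; have d := is_derive_powR_exponent 1 a t0.
by apply: is_derive_eq; rewrite /GRing.scale/= mulr0 add0r /beta_kernel; ring.
Qed.

(** Differentiation under the integral sign.  For exponents above [a / 2] the
derivative of the integrand is dominated by its absolute value at [a / 2],
because [t < 1]. *)
Lemma is_derive_beta_mass_exponent (R : realType) (a b z : R) : 0 < a -> 0 < b -> z <= 1 ->
  is_derive a 1 (fun x => beta_mass x b z) (- beta_log_mass a b z).
Proof.
move=> a0 b0 z1; rewrite /beta_mass /beta_log_mass.
have sub : `]0, z[ `<=` `]0, 1[.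
  by move=> t; rewrite /= !in_itv/= => /andP[-> /lt_le_trans]; exact.
have a20 : 0 < a / 2 by rewrite divr_gt0.
pose G t : R := `|- ln t * beta_kernel (a / 2) b t|.
have dk x t : t \in `]0, z[ -> derive1 (fun y => beta_kernel y b t) x = ln t * beta_kernel x b t.
  rewrite in_itv/= => /andP[t0 _]; rewrite derive1E.
  by have /@derive_val := is_derive_beta_kernel x b t0.
have bound x t : x \in `]a / 2, 2 * a[ -> t \in `]0, z[ ->
    `|derive1 (fun y => beta_kernel y b t) x| <= G t.
  move=> xa tz; rewrite dk//; move: xa tz; rewrite !in_itv/= => /andP[ax _] /andP[t0 tz].
  have t1 : t < 1 by rewrite (lt_le_trans tz).
  rewrite /G mulNr normrN !normrM ler_wpM2l// ler_wpM2r//.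
  rewrite !ger0_norm ?powR_ge0// ger_powR ?t0 ?(ltW t1)//.
  by rewrite lerD2r ltW.
have ia x : 0 < x -> mu.-integrable `]0, z[ (EFin \o beta_kernel x b).
  by move=> x0; apply: integrableS (integrable_beta_kernel x0 b0).
have iG : mu.-integrable `]0, z[ (EFin \o G).
  have i := integrable_ln_beta_kernel a20 b0.
  have := @integrableS _ _ _ mu _ `]0, z[ _ _ _ sub i.
  by move=> /(_ (measurable_itv _) (measurable_itv _))/integrable_norm.
have aI : a \in `]a / 2, 2 * a[ by rewrite in_itv/=; apply/andP; split; lra.
have L := @cvg_differentiation_under_integral R _ _ mu (fun x t => beta_kernel x b t)
  `]0, z[%classic (measurable_itv _) a (a / 2) (2 * a) aI _ _ G _ iG bound.
have {L} : h^-1 *: (\int[mu]_(t in `]0, z[) beta_kernel (h + a) b t -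
      \int[mu]_(t in `]0, z[) beta_kernel a b t) @[h --> 0^'] -->
    - \int[mu]_(t in `]0, z[) (- ln t * beta_kernel a b t).
  have -> : - (\int[mu]_(t in `]0, z[) (- ln t * beta_kernel a b t)) =
      \int[mu]_(t in `]0, z[) partial1of2 (fun x t => beta_kernel x b t) a t.
    rewrite -mulN1r -RintegralZl//; last exact: integrableS (integrable_ln_beta_kernel a0 b0).
    apply: eq_Rintegral => t /set_mem tz.
    by rewrite mulN1r mulNr opprK /partial1of2 dk.
  apply: L => //.
  - by move=> x; rewrite /= in_itv/= => /andP[ax _]; apply: ia; rewrite (lt_trans _ ax).
  - move=> x t _; rewrite /= in_itv/= => /andP[t0 _].
    by have [] := is_derive_beta_kernel x b t0.
  - by move=> t; exact: normr_ge0.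
move=> L; split; last first.
  by apply/cvg_lim => //; under eq_fun do rewrite scaler1.
apply/cvg_ex; eexists; under eq_fun do rewrite scaler1.
exact: L.
Qed.

Lemma integrable_beta_kernelS (R : realType) (a b : R) (D : set R) :
  0 < a -> 0 < b -> measurable D -> D `<=` `]0, 1[ ->
  mu.-integrable D (EFin \o beta_kernel a b).
Proof. by move=> a0 b0 mD sD; apply: integrableS (integrable_beta_kernel a0 b0). Qed.

Lemma Rintegral_itv0_split (R : realType) (f : R -> R) (z w : R) :
  mu.-integrable `]0, w[ (EFin \o f) -> 0 < z -> z < w ->
  \int[mu]_(t in `]0, w[) f t =
  \int[mu]_(t in `]0, z[) f t + \int[mu]_(t in `]z, w[) f t.
Proof.
move=> fi z0 zw.
have e : `]0, w[%classic = `]0, z[%classic `|` `[z, w[%classic.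
  apply/seteqP; split => t; rewrite /= !in_itv/=.
    by move=> /andP[-> ->]; case: (ltP t z) => ?; [left|right].
  move=> [/andP[-> /lt_trans]|/andP[zt ->]]; first exact.
  by rewrite andbT (lt_le_trans z0).
have fz : mu.-integrable `]z, w[ (EFin \o f).
  apply: integrableS fi => // t; rewrite /= !in_itv/= => /andP[zt ->].
  by rewrite (lt_trans z0).
rewrite e Rintegral_setU//=; [|by rewrite -e|]; last first.
  apply/disj_setPRL => t /=; rewrite !in_itv/= => /andP[zt _] /andP[_].
  by rewrite ltNge zt.
by rewrite (@Rintegral_itv_obnd_cbnd _ z).
Qed.

Lemma beta_mass_lt (R : realType) (a b z w : R) : 0 < a -> 0 < b ->
  0 < z -> z < w -> w <= 1 ->
  beta_mass a b z < beta_mass a b w.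
Proof.
move=> a0 b0 z0 zw w1; rewrite /beta_mass (Rintegral_itv0_split _ z0 zw); last first.
  apply: integrable_beta_kernelS => // t; rewrite /= !in_itv/= => /andP[-> tw].
  by rewrite (lt_le_trans tw).
have sub : `]z, w[ `<=` `]0, 1[.
  move=> t; rewrite /= !in_itv/= => /andP[zt tw].
  by rewrite (lt_trans z0 zt) (lt_le_trans tw).
rewrite ltrDl; apply: Rintegral_gt0 => //.
- by rewrite /= lebesgue_measure_itv/= lte_fin zw -EFinD eqe subr_eq0 gt_eqF.
- exact: integrable_beta_kernelS.
- by move=> t /sub; rewrite /= in_itv; exact: beta_kernel_gt0.
Qed.

Lemma is_derive_beta_mass_endpoint (R : realType) (a b z : R) : 0 < a -> 0 < b ->
  0 < z < 1 ->
  is_derive z 1 (beta_mass a b) (beta_kernel a b z).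
Proof.
move=> a0 b0 /andP[z0 z1].
pose U := (fun z : R => \int[mu]_(t in `]0, z]) beta_kernel a b t) : R -> R.
suff : is_derive z 1 U (beta_kernel a b z).
  apply: near_eq_is_derive; near=> w; rewrite /U /beta_mass; rewrite Rintegral_itv_bndo_bndc//.
  apply: integrable_beta_kernelS => // t; rewrite /= !in_itv/= => /andP[-> tw].
  by rewrite (lt_trans tw)//; near: w; exact: lt_nbhsl.
have iu : mu.-integrable `]0, (1 + z) / 2] (EFin \o beta_kernel a b).
  apply: integrable_beta_kernelS => // t; rewrite /= !in_itv/= => /andP[-> tz].
  by rewrite (le_lt_trans tz)//; lra.
have zu : z < (1 + z) / 2 by lra.
have cz : {for z, continuous (beta_kernel a b)} by apply: continuous_beta_kernel; rewrite z0.
have [d e] := @continuous_FTC1 R (beta_kernel a b) (BRight 0) z ((1 + z) / 2) zu iu z0 cz.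
by split => //; rewrite -derive1E.
Unshelve. all: by end_near. Qed.

(** * The derivative of the quantile *)

(** The sign of [beta_mass x b z - p * beta_mass x b 1] tells on which side of
[z] the quantile lies, and for fixed [z] it is stable under small changes of
[x]. *)
Lemma continuous_quantile (R : realType) (p b : R) (q : R -> R) (a : R) :
  0 < b ->
  (forall a, 0 < a -> 0 < q a < 1) ->
  (forall a, 0 < a -> beta_mass a b (q a) = p * beta_mass a b 1) ->
  0 < a -> {for a, continuous q}.
Proof.
move=> b0 q01 qp a0; have /andP[qa0 qa1] := q01 _ a0.
apply/cvgrPdist_lt => /= e e0.
pose F z x := beta_mass x b z - p * beta_mass x b 1.
have cF z : z <= 1 -> {for a, continuous (F z)}.
  move=> z1; have d1 := is_derive_beta_mass_exponent a0 b0 z1.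
  have d2 := is_derive_beta_mass_exponent a0 b0 (lexx 1).
  by apply/differentiable_continuous/derivable1_diffP; rewrite /F.
pose lo := Num.max (q a - e) (q a / 2); pose hi := Num.min (q a + e) ((1 + q a) / 2).
have lo0 : 0 < lo by rewrite lt_max; apply/orP; right; lra.
have loq : lo < q a by rewrite gt_max; apply/andP; split; lra.
have hi1 : hi < 1 by rewrite gt_min; apply/orP; right; lra.
have qhi : q a < hi by rewrite lt_min; apply/andP; split; lra.
have Flo : F lo a < 0 by rewrite subr_lt0 -qp// beta_mass_lt// ltW.
have Fhi : 0 < F hi a by rewrite subr_gt0 -qp// beta_mass_lt// ltW.
have lo1 : lo <= 1 by rewrite ltW// (lt_trans loq).
have nlo : \forall x \near a, F lo x < 0.
  exact: (cvgr_lt _ (cF _ lo1) _ Flo).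
have nhi : \forall x \near a, 0 < F hi x.
  exact: (cvgr_gt _ (cF _ (ltW hi1)) _ Fhi).
near=> x.
have x0 : 0 < x by near: x; exact: lt_nbhsr.
have /andP[qx0 qx1] := q01 _ x0.
have qlo : lo < q x.
  rewrite ltNge; apply/negP => qx.
  have : F lo x < 0 by near: x.
  rewrite /F subr_lt0 -qp// ltNge; move: qx; rewrite le_eqVlt => /predU1P[->|qx].
    by rewrite lexx.
  by rewrite ltW// beta_mass_lt.
have qhi' : q x < hi.
  rewrite ltNge; apply/negP => qx.
  have : 0 < F hi x by near: x.
  rewrite /F subr_gt0 -qp// ltNge; move: qx; rewrite le_eqVlt => /predU1P[->|qx].
    by rewrite lexx.
  by rewrite ltW// beta_mass_lt// ?(ltW qx1)// (lt_trans qa0).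
have : q a - e < q x by rewrite (le_lt_trans _ qlo)// le_max lexx.
have : q x < q a + e by rewrite (lt_le_trans qhi')// ge_min lexx.
by move=> h1 h2; rewrite ltr_norml; apply/andP; split; lra.
Unshelve. all: by end_near. Qed.

Lemma cvg_beta_kernel (R : realType) (a b l : R) (c : R -> R) :
  0 < l < 1 -> c x @[x --> a] --> l ->
  beta_kernel x b (c x) @[x --> a] --> beta_kernel a b l.
Proof.
move=> /andP[l0 l1] cl.
rewrite /beta_kernel; apply: cvgM; last first.
  have h : (1 - y) `^ (b - 1) @[y --> l] --> (1 - l) `^ (b - 1).
    exact: continuous_onem_powR.
  exact: (cvg_comp _ _ cl h).
have -> : l `^ (a - 1) = expR ((a - 1) * ln l) by rewrite /powR gt_eqF.
apply: (@cvg_trans _ (expR ((x - 1) * ln (c x)) @[x --> a])).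
  apply: near_eq_cvg; near=> x; rewrite /powR gt_eqF//; near: x.
  exact: (cvgr_gt _ cl _ l0).
apply: (cvg_comp (fun x => (x - 1) * ln (c x)) expR); last exact: continuous_expR.
apply: cvgM.
  by apply: cvgB; [exact: cvg_id|exact: cvg_cst].
have h : ln y @[y --> l] --> ln l by exact: continuous_ln.
exact: (cvg_comp _ _ cl h).
Unshelve. all: by end_near. Qed.

Lemma beta_mass_mean_value (R : realType) (a b z w : R) : 0 < a -> 0 < b ->
  0 < z < 1 -> 0 < w < 1 ->
  exists c, [/\ 0 < c < 1, `|c - z| <= `|w - z| &
    beta_mass a b w - beta_mass a b z = beta_kernel a b c * (w - z)].
Proof.
move=> a0 b0.
have H (x y : R) : 0 < x < 1 -> 0 < y < 1 -> x <= y ->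
    exists c, [/\ 0 < c < 1, x <= c <= y &
      beta_mass a b y - beta_mass a b x = beta_kernel a b c * (y - x)].
  move=> /andP[x0 x1] /andP[y0 y1] xy.
  have xy01 t : t \in `[x, y] -> 0 < t < 1.
    by rewrite in_itv/= => /andP[xt ty]; rewrite (lt_le_trans x0 xt) (le_lt_trans ty).
  have [||c cxy e] := @MVT_segment R (beta_mass a b) (beta_kernel a b) x y xy.
  - by move=> t /subset_itv_oo_cc/xy01; exact: is_derive_beta_mass_endpoint.
  - apply: derivable_within_continuous => t /xy01 t01.
    by have [] := is_derive_beta_mass_endpoint a0 b0 t01.
  - by exists c; split => //; exact: xy01.
move=> z01 w01; have [zw|wz] := leP z w.
  have [c [c01 /andP[zc cw] e]] := H _ _ z01 w01 zw; exists c; split => //.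
  by rewrite !ger0_norm ?subr_ge0// lerD2r.
have [c [c01 /andP[wc cz] e]] := H _ _ w01 z01 (ltW wz); exists c; split => //.
  by rewrite !ler0_norm ?subr_le0 ?(ltW wz)// lerN2 lerD2r.
by rewrite -opprB e -mulrN opprB.
Qed.

(** Let [N x = p * beta_mass x b 1 - beta_mass x b (q a)].  By the quantile
equation at [x] and the mean value theorem in the endpoint,
[N x = beta_kernel x b c * (q x - q a)] with [c] between [q a] and [q x].
So [q x - q a] is [N x] divided by a quantity that tends to
[beta_kernel a b (q a)], and [N] is differentiable with [N a = 0]. *)
Lemma is_derive_quantile (R : realType) (p b : R) (q : R -> R) (a : R) :
  0 < b ->
  (forall a, 0 < a -> 0 < q a < 1) ->
  (forall a, 0 < a -> beta_mass a b (q a) = p * beta_mass a b 1) ->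
  0 < a ->
  is_derive a 1 q ((beta_log_mass a b (q a) - p * beta_log_mass a b 1) / beta_kernel a b (q a)).
Proof.
move=> b0 q01 qp a0; have qa01 := q01 _ a0; have /andP[qa0 qa1] := qa01.
pose N x := p * beta_mass x b 1 - beta_mass x b (q a).
have Na : N a = 0 by rewrite /N qp// subrr.
have dN : is_derive a 1 N (beta_log_mass a b (q a) - p * beta_log_mass a b 1).
  have d1 := is_derive_beta_mass_exponent a0 b0 (ltW qa1).
  have d2 := is_derive_beta_mass_exponent a0 b0 (lexx 1).
  by apply: is_derive_eq; rewrite /GRing.scale/=; ring.
have /choice[c cP] : forall x, exists c, 0 < x ->
    [/\ 0 < c < 1, `|c - q a| <= `|q x - q a| & N x = beta_kernel x b c * (q x - q a)].
  move=> x; have [x0|x0] := ltP 0 x; last by exists 0.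
  have [c [c01 cq e]] := beta_mass_mean_value x0 b0 qa01 (q01 _ x0).
  by exists c => _; split => //; rewrite -e qp.
have cq := continuous_quantile b0 q01 qp a0.
have cc : c x @[x --> a] --> q a.
  apply/cvgrPdist_lt => e e0.
  have /cvgrPdist_lt/(_ _ e0) cqe := cq.
  near=> x; have x0 : 0 < x by near: x; exact: lt_nbhsr.
  have [_ cx _] := cP _ x0; rewrite distrC (le_lt_trans cx)// distrC.
  by near: x.
have ck := cvg_beta_kernel (b := b) qa01 cc.
have k0 : beta_kernel a b (q a) != 0 by rewrite gt_eqF// beta_kernel_gt0.
have [dNa eN] := dN.
have LN : h^-1 *: (N (h *: 1 + a) - N a) @[h --> 0^'] -->
    beta_log_mass a b (q a) - p * beta_log_mass a b 1.
  by rewrite -eN; exact: dNa.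
have sh : (h *: 1 + a : R) @[h --> (0:R)^'] --> a.
  have : (h *: 1 + a : R) @[h --> (0:R)] --> 0 *: 1 + a.
    by apply: cvgD; [apply: cvgZr_tmp; exact: cvg_id|exact: cvg_cst].
  by rewrite scale0r add0r; exact: cvg_within_filter.
have L : h^-1 *: (q (h *: 1 + a) - q a) @[h --> 0^'] -->
    (beta_log_mass a b (q a) - p * beta_log_mass a b 1) / beta_kernel a b (q a).
  apply: (@cvg_trans _ (((h^-1 *: (N (h *: 1 + a) - N a)) /
    beta_kernel (h *: 1 + a) b (c (h *: 1 + a))) @[h --> (0 : R)^'])); last first.
    apply: cvgM => //; apply: cvgV => //.
    exact: (cvg_comp _ _ sh ck).
  apply: near_eq_cvg; near=> h.
  have h0 : 0 < h *: 1 + a by near: h; exact: (cvgr_gt _ sh _ a0).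
  (* Here [N] is rewritten by the mean value identity, and the factor
     [beta_kernel] at the intermediate point cancels. *)
  have [c01 _ ->] := cP _ h0.
  rewrite Na subr0 /GRing.scale/= -mulrA [X in _ * X]mulrC mulKf//.
  by rewrite gt_eqF// beta_kernel_gt0.
split; last exact/cvg_lim.
by apply/cvg_ex; eexists; exact: L.
Unshelve. all: by end_near. Qed.

(** * The beta density in a logarithmic coordinate *)

(** The density [beta_kernel a b t] in the coordinate [t = z * expR (s / a)], up
to the factor [z `^ a / a]; see [beta_kernel_substE]. *)
Definition log_kernel (R : realType) (z a b s : R) : R :=
  expR s * (1 - z * expR (s / a)) `^ (b - 1).

Lemma log_kernel_gt0 (R : realType) (z a b s : R) : z * expR (s / a) < 1 -> 0 < log_kernel z a b s.
Proof. by move=> s1; rewrite mulr_gt0 ?expR_gt0// powR_gt0// subr_gt0. Qed.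

Lemma beta_kernel_substE (R : realType) (z a b s : R) : 0 < z -> 0 < a ->
  beta_kernel a b (z * expR (s / a)) * (z * expR (s / a) / a) =
  z `^ a / a * log_kernel z a b s.
Proof.
move=> z0 a0; have t0 : 0 <= z * expR (s / a) by rewrite mulr_ge0 ?expR_ge0 ?ltW.
rewrite /beta_kernel /log_kernel.
have -> : z `^ a / a * (expR s * (1 - z * expR (s / a)) `^ (b - 1)) =
  (z `^ a * expR s) * (1 - z * expR (s / a)) `^ (b - 1) / a by ring.
have -> : z `^ a * expR s = (z * expR (s / a)) `^ a.
  by rewrite powRM ?expR_ge0 ?ltW// -expRM divfK// gt_eqF.
by rewrite -[in RHS](mulr_powRB1 t0 a0); ring.
Qed.

Lemma continuous_log_kernel (R : realType) (z a b s : R) : z * expR (s / a) < 1 ->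
  {for s, continuous (log_kernel z a b)}.
Proof.
move=> s1; apply: cvgM; first exact: continuous_expR.
have h : (1 - y) `^ (b - 1) @[y --> z * expR (s / a)] -->
    (1 - z * expR (s / a)) `^ (b - 1) by exact: continuous_onem_powR.
apply: (cvg_comp _ _ _ h); apply: cvgMl_tmp.
apply: (cvg_comp (fun x => x / a) expR); last exact: continuous_expR.
by apply: cvgMr_tmp; exact: cvg_id.
Qed.

(** The weight [W] is evaluated at the coordinate [s = a * ln (t / z)]; it will
be [1], [s] or [- s], according as masses or first moments are computed. *)
Lemma weighted_beta_kernel_subst (R : realType) (z a b : R) (W : R -> R)
    (i j : interval R) (u v : nat -> R) :
  0 < z -> 0 < a -> (forall n, u n <= v n) ->
  nonincreasing_seq u -> nondecreasing_seq v ->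
  open [set` i] ->
  [set` i] = \bigcup_n `[u n, v n]%classic ->
  [set` j] `<=` `]0, 1[ -> (forall s, (z * expR (s / a) \in j) = (s \in i)) ->
  (forall s, s \in i -> 0 <= W s) -> continuous W ->
  mu.-integrable [set` j] (EFin \o (fun t => W (a * ln (t / z)) * beta_kernel a b t)) ->
  mu.-integrable [set` i] (EFin \o (fun s => W s * log_kernel z a b s)) /\
  \int[mu]_(t in [set` j]) (W (a * ln (t / z)) * beta_kernel a b t) =
  z `^ a / a * \int[mu]_(s in [set` i]) (W s * log_kernel z a b s).
Proof.
move=> z0 a0 uv nu nv oi ei j01 ji W0 cW ij.
pose G t := W (a * ln (t / z)) * beta_kernel a b t.
have lnE s : a * ln (z * expR (s / a) / z) = s.
  by rewrite mulrAC divff ?gt_eqF// mul1r expRK mulrC divfK// gt_eqF.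
have jE t : t \in j -> exists2 s, s \in i & t = z * expR (s / a).
  move=> tj; have := j01 _ tj; rewrite /= in_itv/= => /andP[t0 _].
  exists (a * ln (t / z)); last first.
    rewrite mulrAC divff ?gt_eqF// mul1r lnK ?posrE ?divr_gt0//.
    by rewrite mulrCA divff ?gt_eqF// mulr1.
  rewrite -ji mulrAC divff ?gt_eqF// mul1r lnK ?posrE ?divr_gt0//.
  by rewrite mulrCA divff ?gt_eqF// mulr1.
have i1 s : s \in i -> 0 < z * expR (s / a) < 1.
  by rewrite -ji => /j01; rewrite /= in_itv.
have e : (\int[mu]_(t in [set` j]) (G t)%:E =
    \int[mu]_(s in [set` i]) (z `^ a / a * (W s * log_kernel z a b s))%:E)%E.
  rewrite (@ge0_integration_by_substitution_expR R z a G [set` i] [set` j] u v)//.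
  - by apply: eq_integral => s _; rewrite /G lnE -mulrA beta_kernel_substE//; congr EFin; ring.
  - by move=> t /j01; rewrite /= !in_itv/= => /andP[->].
  - by move=> s /=; rewrite ji.
  - move=> t /jE[s si ->]; rewrite /G lnE mulr_ge0 ?W0// ltW// beta_kernel_gt0//.
    exact: i1.
  - move=> t tj; have := j01 _ tj; rewrite /= in_itv/= => t01; have /andP[t0 t1] := t01.
    apply: cvgM; last exact: continuous_beta_kernel.
    apply: (cvg_comp (fun t => a * ln (t / z)) W); last exact: cW.
    have h : ln y @[y --> t / z] --> ln (t / z).
      by apply: continuous_ln; rewrite divr_gt0.
    apply: cvgMl_tmp; apply: (cvg_comp _ _ _ h).
    by apply: cvgMr_tmp; exact: cvg_id.
have c0 : 0 < z `^ a / a by rewrite divr_gt0// powR_gt0.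
have mk : measurable_fun [set` i] (fun s => W s * log_kernel z a b s).
  apply: continuous_measurable_fun_itvoo => // s si.
  apply: cvgM; first exact: cW.
  by apply: continuous_log_kernel; have /andP[] := i1 _ si.
have Wk0 s : s \in i -> 0 <= W s * log_kernel z a b s.
  by move=> si; rewrite mulr_ge0 ?W0// ltW// log_kernel_gt0//; have /andP[] := i1 _ si.
have ick : mu.-integrable [set` i] (EFin \o (fun s => z `^ a / a * (W s * log_kernel z a b s))).
  apply/integrableP; split.
    by apply/measurable_EFinP; apply: measurable_funM => //; exact: measurable_cst.
  have abs s : s \in [set` i] -> `|(z `^ a / a * (W s * log_kernel z a b s))%:E|%E =
      (z `^ a / a * (W s * log_kernel z a b s))%:E.
    by move=> /set_mem si; rewrite /= ger0_norm// mulr_ge0 ?Wk0// ltW.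
  under eq_integral do rewrite abs//.
  rewrite -e.
  by rewrite ltey_eq (integrable_fin_num _ ij).
have ik : mu.-integrable [set` i] (EFin \o (fun s => W s * log_kernel z a b s)).
  have := integrable_EFinZl (z `^ a / a)^-1 _ ick.
  move=> /(_ (measurable_itv i)); apply: eq_integrable => // s _ /=; congr EFin.
  by rewrite mulKf// gt_eqF.
split => //.
by rewrite -RintegralZl// /Rintegral e.
Qed.

Lemma weighted_beta_kernel_subst_below (R : realType) (z a b m w : R) (W : R -> R) :
  0 < z -> 0 < a -> w = z * expR (m / a) -> w <= 1 ->
  (forall s, s < m -> 0 <= W s) -> continuous W ->
  mu.-integrable `]0, w[ (EFin \o (fun t => W (a * ln (t / z)) * beta_kernel a b t)) ->
  mu.-integrable `]-oo, m[ (EFin \o (fun s => W s * log_kernel z a b s)) /\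
  \int[mu]_(t in `]0, w[) (W (a * ln (t / z)) * beta_kernel a b t) =
  z `^ a / a * \int[mu]_(s in `]-oo, m[) (W s * log_kernel z a b s).
Proof.
move=> z0 a0 wE w1 W0 cW.
apply: (@weighted_beta_kernel_subst R z a b W `]-oo, m[ `]0, w[
  (fun k => m - k%:R - 1) (fun k => m - k.+1%:R^-1)) => //.
- move=> n; rewrite -addrA lerD2l -opprD lerN2.
  rewrite (@le_trans _ _ 1) ?lerDr// invf_le1 ?ler1n//.
- by move=> i j ij; rewrite lerD2r lerD2l lerN2 ler_nat.
- by move=> i j ij; rewrite lerD2l lerN2 lef_pV2 ?posrE// ler_nat.
- exact: itvNyo_bigcup_itvcc.
- by move=> t; rewrite /= !in_itv/= => /andP[-> /lt_le_trans]; exact.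
- move=> s; rewrite !in_itv/= mulr_gt0 ?expR_gt0//= wE.
  by rewrite ltr_pM2l// ltr_expR ltr_pM2r// invr_gt0.
Qed.

Lemma weighted_beta_kernel_subst_between (R : realType) (z a b m n w x : R) (W : R -> R) :
  0 < z -> 0 < a -> m < n -> w = z * expR (m / a) -> x = z * expR (n / a) -> x <= 1 ->
  (forall s, m < s < n -> 0 <= W s) -> continuous W ->
  mu.-integrable `]w, x[ (EFin \o (fun t => W (a * ln (t / z)) * beta_kernel a b t)) ->
  mu.-integrable `]m, n[ (EFin \o (fun s => W s * log_kernel z a b s)) /\
  \int[mu]_(t in `]w, x[) (W (a * ln (t / z)) * beta_kernel a b t) =
  z `^ a / a * \int[mu]_(s in `]m, n[) (W s * log_kernel z a b s).
Proof.
move=> z0 a0 mn wE xE x1 W0 cW; have nm : 0 < n - m by rewrite subr_gt0.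
apply: (@weighted_beta_kernel_subst R z a b W `]m, n[ `]w, x[
  (fun k => m + (n - m) * k.+2%:R^-1) (fun k => n - (n - m) * k.+2%:R^-1)) => //.
- move=> k; rewrite lerBrDr -addrA -mulrDr -lerBrDl ler_piMr ?(ltW nm)//.
  have : (k.+2%:R^-1 : R) <= 2^-1 by rewrite lef_pV2 ?posrE// ler_nat.
  by move: (k.+2%:R^-1) => y h; rewrite -[leRHS](@mulVf R 2)// mulr2n mulrDr mulr1 lerD.
- by move=> i j ij; rewrite lerD2l ler_pM2l// lef_pV2 ?posrE// ler_nat !ltnS.
- by move=> i j ij; rewrite lerD2l lerN2 ler_pM2l// lef_pV2 ?posrE// ler_nat !ltnS.
- exact: itvoo_bigcup_itvcc.
- move=> t; rewrite /= !in_itv/= => /andP[wt tx]; rewrite (lt_le_trans tx)// andbT.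
  by rewrite (lt_trans _ wt)// wE mulr_gt0// expR_gt0.
- move=> s; rewrite !in_itv/= wE xE.
  by rewrite !ltr_pM2l// !ltr_expR !ltr_pM2r// invr_gt0.
Qed.

(** * Monotonicity of the scaled logarithm of the quantile *)

Lemma ltr_powR_neg (R : realType) (r x y : R) : r < 0 -> 0 < x -> x < y ->
  y `^ r < x `^ r.
Proof.
move=> r0 x0 xy; have y0 := lt_trans x0 xy.
rewrite -(opprK r) (powRN x) (powRN y) ltf_pV2 ?posrE ?powR_gt0//.
by rewrite gt0_ltr_powR ?oppr_gt0// nnegrE ltW.
Qed.

Lemma powR_cross_lt (R : realType) (r x0 x1 y0 y1 : R) : r < 0 ->
  0 < x0 -> 0 < x1 -> 0 < y0 -> 0 < y1 -> y0 * x1 < y1 * x0 ->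
  y1 `^ r * x0 `^ r < y0 `^ r * x1 `^ r.
Proof.
move=> r0 x00 x10 y00 y10 h; rewrite -!powRM ?ltW//.
by apply: ltr_powR_neg => //; rewrite mulr_gt0.
Qed.

Lemma one_sub_expR_gt0 (R : realType) (s a : R) : 0 < s -> 0 < a ->
  0 < 1 - expR (- s / a).
Proof. by move=> s0 a0; rewrite subr_gt0 expR_lt1 mulNr oppr_lt0 divr_gt0. Qed.

(** The passage from the pair [(a0, l0)] to [(a1, l1)] is made through
[(a0, l1)].  With [x0 = expR (- l0 / a0)] and
[x1 = expR (- l1 / a0)], changing [l] at fixed [a0] amounts to
[(x1 - x0) * (1 - expR (v / a0)) >= 0]; changing [a] is
[one_sub_expR_ratio_lt]. *)
Lemma below_cross_lt (R : realType) (a0 a1 l0 l1 v : R) :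
  0 < a0 -> a0 < a1 -> 0 < l1 -> l1 <= l0 -> v < 0 ->
  (1 - expR ((v - l0) / a0)) * (1 - expR (- l1 / a1)) <
  (1 - expR ((v - l1) / a1)) * (1 - expR (- l0 / a0)).
Proof.
move=> a00 a01 l10 l01 v0.
have l00 := lt_le_trans l10 l01.
have a10 := lt_trans a00 a01.
have h := one_sub_expR_ratio_lt l10 (_ : l1 < l1 - v) a00 a01.
have {h} := h (ltac:(rewrite ltrDl oppr_gt0//)); rewrite opprB.
have X0 := one_sub_expR_gt0 l10 a00.
have X1 := one_sub_expR_gt0 l10 a10.
have X00 := one_sub_expR_gt0 l00 a00.
have k1 : expR (v / a0) < 1 by rewrite expR_lt1 pmulr_llt0 ?invr_gt0.
have x01 : expR (- l0 / a0) <= expR (- l1 / a0).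
  by rewrite ler_expR ler_pM2r ?invr_gt0// lerN2.
have e0 : expR ((v - l0) / a0) = expR (v / a0) * expR (- l0 / a0) by rewrite mulrBl expRD mulNr.
have e1 : expR ((v - l1) / a0) = expR (v / a0) * expR (- l1 / a0) by rewrite mulrBl expRD mulNr.
rewrite e0 e1.
move: X0 X1 X00 k1 x01; move: (expR (v / a0)) (expR (- l0 / a0)) (expR (- l1 / a0)).
move=> k x0 x1; move: (expR (- l1 / a1)) (expR ((v - l1) / a1)) => z1 y1.
move=> X1 Z1 X0 k1 x01 h.
rewrite -(ltr_pM2r X1).
have s1 : (1 - k * x0) * (1 - x1) <= (1 - k * x1) * (1 - x0).
  rewrite -subr_ge0.
  have -> : (1 - k * x1) * (1 - x0) - (1 - k * x0) * (1 - x1) = (x1 - x0) * (1 - k) by ring.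
  by rewrite mulr_ge0// subr_ge0// ltW.
have s2 := ler_wpM2r (ltW Z1) s1.
have s3 : (1 - k * x1) * (1 - z1) * (1 - x0) < (1 - y1) * (1 - x1) * (1 - x0).
  by rewrite ltr_pM2r.
lra.
Qed.

(** Both steps of [below_cross_lt] reverse when [v] is positive. *)
Lemma above_cross_lt (R : realType) (a0 a1 l0 l1 v : R) :
  0 < a0 -> a0 < a1 -> l1 <= l0 -> 0 < v < l1 ->
  (1 - expR ((v - l1) / a1)) * (1 - expR (- l0 / a0)) <
  (1 - expR ((v - l0) / a0)) * (1 - expR (- l1 / a1)).
Proof.
move=> a00 a01 l01 /andP[v0 vl1].
have l10 := lt_trans v0 vl1.
have l00 := lt_le_trans l10 l01.
have a10 := lt_trans a00 a01.
have h := one_sub_expR_ratio_lt (_ : 0 < l1 - v) (_ : l1 - v < l1) a00 a01.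
have {h} := h (ltac:(by rewrite subr_gt0)) (ltac:(by rewrite gtrBl)); rewrite opprB.
have X0 := one_sub_expR_gt0 l10 a00.
have X1 := one_sub_expR_gt0 l10 a10.
have X00 := one_sub_expR_gt0 l00 a00.
have k1 : 1 < expR (v / a0) by rewrite expR_gt1 divr_gt0.
have x01 : expR (- l0 / a0) <= expR (- l1 / a0).
  by rewrite ler_expR ler_pM2r ?invr_gt0// lerN2.
have e0 : expR ((v - l0) / a0) = expR (v / a0) * expR (- l0 / a0) by rewrite mulrBl expRD mulNr.
have e1 : expR ((v - l1) / a0) = expR (v / a0) * expR (- l1 / a0) by rewrite mulrBl expRD mulNr.
rewrite e0 e1.
move: X0 X1 X00 k1 x01; move: (expR (v / a0)) (expR (- l0 / a0)) (expR (- l1 / a0)).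
move=> k x0 x1; move: (expR (- l1 / a1)) (expR ((v - l1) / a1)) => z1 y1.
move=> X1 Z1 X0 k1 x01 h.
rewrite -(ltr_pM2r X1).
have s1 : (1 - k * x1) * (1 - x0) <= (1 - k * x0) * (1 - x1).
  rewrite -subr_ge0.
  have -> : (1 - k * x0) * (1 - x1) - (1 - k * x1) * (1 - x0) = (x1 - x0) * (k - 1) by ring.
  by rewrite mulr_ge0// subr_ge0// ltW.
have s2 := ler_wpM2r (ltW Z1) s1.
have s3 : (1 - x1) * (1 - y1) * (1 - x0) < (1 - z1) * (1 - k * x1) * (1 - x0).
  by rewrite ltr_pM2r.
lra.
Qed.

Lemma beta_mass1_split (R : realType) (a b z : R) : 0 < a -> 0 < b -> 0 < z < 1 ->
  beta_mass a b 1 = beta_mass a b z + \int[mu]_(t in `]z, 1[) beta_kernel a b t.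
Proof.
move=> a0 b0 /andP[z0 z1]; apply: Rintegral_itv0_split => //.
exact: integrable_beta_kernel.
Qed.

Lemma beta_kernel_subst_below (R : realType) (z a b m w : R) :
  0 < z -> 0 < a -> 0 < b -> w = z * expR (m / a) -> w <= 1 ->
  mu.-integrable `]-oo, m[ (EFin \o log_kernel z a b) /\
  beta_mass a b w = z `^ a / a * \int[mu]_(s in `]-oo, m[) log_kernel z a b s.
Proof.
move=> z0 a0 b0 wE w1.
have iw : mu.-integrable `]0, w[ (EFin \o beta_kernel a b).
  apply: integrable_beta_kernelS => // t; rewrite /= !in_itv/= => /andP[-> /lt_le_trans].
  exact.
have c1 : continuous (fun _ : R => 1 : R) by move=> ?; exact: cvg_cst.
have [|i e] := @weighted_beta_kernel_subst_below R z a b m w (fun=> 1) z0 a0 wE w1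
  (fun _ _ => ler01) c1.
  by apply: eq_integrable iw => // t _ /=; rewrite mul1r.
split; first by apply: eq_integrable i => // t _ /=; rewrite mul1r.
transitivity (\int[mu]_(t in `]0, w[) (1 * beta_kernel a b t)).
  by apply: eq_Rintegral => t _; rewrite mul1r.
by rewrite e; congr (_ * _); apply: eq_Rintegral => s _; rewrite mul1r.
Qed.

Lemma beta_kernel_subst_between (R : realType) (z a b m n w x : R) :
  0 < z -> 0 < a -> 0 < b -> m < n ->
  w = z * expR (m / a) -> x = z * expR (n / a) -> x <= 1 ->
  mu.-integrable `]m, n[ (EFin \o log_kernel z a b) /\
  \int[mu]_(t in `]w, x[) beta_kernel a b t =
  z `^ a / a * \int[mu]_(s in `]m, n[) log_kernel z a b s.
Proof.
move=> z0 a0 b0 mn wE xE x1.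
have iw : mu.-integrable `]w, x[ (EFin \o beta_kernel a b).
  apply: integrable_beta_kernelS => // t; rewrite /= !in_itv/= => /andP[wt tx].
  by rewrite (lt_le_trans tx)// andbT (lt_trans _ wt)// wE mulr_gt0// expR_gt0.
have c1 : continuous (fun _ : R => 1 : R) by move=> ?; exact: cvg_cst.
have [|i e] := @weighted_beta_kernel_subst_between R z a b m n w x (fun=> 1) z0 a0 mn wE
  xE x1 (fun _ _ => ler01) c1.
  by apply: eq_integrable iw => // t _ /=; rewrite mul1r.
split; first by apply: eq_integrable i => // t _ /=; rewrite mul1r.
transitivity (\int[mu]_(t in `]w, x[) (1 * beta_kernel a b t)).
  by apply: eq_Rintegral => t _; rewrite mul1r.
by rewrite e; congr (_ * _); apply: eq_Rintegral => s _; rewrite mul1r.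
Qed.

(** The arithmetic of a monotone likelihood ratio: if the second pair of masses
[A1], [C1] is compared with the first through the same factor [r], from above
below the cut and from below above it, then the proportion of mass below the
cut cannot be larger for the second pair. *)
Lemma odds_contradiction (R : realType) (p r x0 x1 A0 A1 C0 C1 : R) :
  0 < p -> p < 1 -> 0 < r -> 0 < x0 -> 0 < x1 ->
  1 / x1 * A1 = p * (1 / x1 * A1 + 1 / x1 * C1) ->
  1 / x0 * A0 < p * (1 / x0 * A0 + 1 / x0 * C0) ->
  A1 <= r * A0 -> r * C0 <= C1 -> False.
Proof.
move=> p0 p1 r0 x00 x10; rewrite !mul1r -!mulrDr => e1 lt0 A10 C01.
have {}e1 : A1 = p * (A1 + C1).
  by apply: (mulfI (_ : x1^-1 != 0)); rewrite ?invr_neq0 ?gt_eqF// e1 mulrCA.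
have {}lt0 : A0 < p * (A0 + C0) by move: lt0; rewrite mulrCA ltr_pM2l ?invr_gt0.
have h1 : (1 - p) * A1 = p * C1 by rewrite mulrBl mul1r {1}e1; ring.
have h0 : (1 - p) * A0 < p * C0 by rewrite mulrBl mul1r ltrBlDl -mulrDr.
have h2 : (1 - p) * A1 <= r * ((1 - p) * A0) by rewrite mulrCA ler_pM2l ?subr_gt0.
have h3 : r * ((1 - p) * A0) < r * (p * C0) by rewrite ltr_pM2l.
have h4 : r * (p * C0) <= p * C1 by rewrite mulrCA ler_pM2l.
by have := lt_le_trans (le_lt_trans h2 h3) h4; rewrite h1 ltxx.
Qed.

(** Suppose [l0 < l1] and cut both densities at [- l1] in the coordinate
[t = expR (s / a)].  The quotient of the second density by the first increases
with [s] by [one_sub_expR_ratio_lt]; let [r] be its value at the cut.  The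
first distribution has mass less than [p] below the cut, since its own
[p]-quantile is [- l0 > - l1], and by [odds_contradiction] so has the second,
whose [p]-quantile is the cut itself. *)
Lemma scaled_log_quantile_le (R : realType) (p b a0 a1 l0 l1 : R) :
  0 < p < 1 -> 0 < b < 1 -> 0 < a0 -> a0 < a1 -> 0 < l0 -> 0 < l1 ->
  beta_mass a0 b (expR (- l0 / a0)) = p * beta_mass a0 b 1 ->
  beta_mass a1 b (expR (- l1 / a1)) = p * beta_mass a1 b 1 ->
  l1 <= l0.
Proof.
move=> /andP[p0 p1] /andP[b0 b1] a00 a01 l00 l10 e0 e1.
have a10 := lt_trans a00 a01.
rewrite leNgt; apply/negP => l01.
have w01 (a l : R) : 0 < a -> 0 < l -> 0 < expR (- l / a) < 1.
  by move=> ? ?; rewrite expR_gt0 expR_lt1 mulNr oppr_lt0 divr_gt0.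
have lo (a : R) : 0 < a -> mu.-integrable `]-oo, - l1[ (EFin \o log_kernel 1 a b) /\
    beta_mass a b (expR (- l1 / a)) = 1 `^ a / a * \int[mu]_(s in `]-oo, - l1[) log_kernel 1 a b s.
  move=> a_gt0; apply: beta_kernel_subst_below => //; first by rewrite mul1r.
  by have /andP[_ /ltW] := w01 a l1 a_gt0 l10.
have up (a : R) : 0 < a -> mu.-integrable `](- l1), 0[ (EFin \o log_kernel 1 a b) /\
    \int[mu]_(t in `]expR (- l1 / a), 1[) beta_kernel a b t =
    1 `^ a / a * \int[mu]_(s in `](- l1), 0[) log_kernel 1 a b s.
  move=> a_gt0; apply: beta_kernel_subst_between => //; first by rewrite oppr_lt0.
    by rewrite mul1r.
  by rewrite mul0r expR0 mulr1.
have [i0 m0] := lo _ a00; have [i1 m1] := lo _ a10.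
have [j0 n0] := up _ a00; have [j1 n1] := up _ a10.
have s0 := beta_mass1_split a00 b0 (w01 _ _ a00 l10).
have s1 := beta_mass1_split a10 b0 (w01 _ _ a10 l10).
have lt0 : beta_mass a0 b (expR (- l1 / a0)) < p * beta_mass a0 b 1.
  rewrite -e0; apply: beta_mass_lt => //; first exact: expR_gt0.
    by rewrite ltr_expR ltr_pM2r ?invr_gt0// ltrN2.
  by have /andP[_ /ltW] := w01 _ _ a00 l00.
rewrite s1 m1 n1 powR1 in e1; rewrite s0 m0 n0 powR1 in lt0.
pose X (a : R) := 1 - expR (- l1 / a).
have X0 : 0 < X a0 by exact: one_sub_expR_gt0.
have X1 : 0 < X a1 by exact: one_sub_expR_gt0.
pose r := X a1 `^ (b - 1) / X a0 `^ (b - 1).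
have r0 : 0 < r by rewrite divr_gt0// powR_gt0.
have b10 : b - 1 < 0 by rewrite subr_lt0.
have kA v : v < - l1 -> log_kernel 1 a1 b v <= r * log_kernel 1 a0 b v.
  move=> vl; have lv : l1 < - v by rewrite ltrNr.
  have := one_sub_expR_ratio_lt l10 lv a00 a01; rewrite opprK => h.
  have Y0 : 0 < 1 - expR (v / a0) by rewrite -(opprK v) one_sub_expR_gt0// (lt_trans l10).
  have Y1 : 0 < 1 - expR (v / a1) by rewrite -(opprK v) one_sub_expR_gt0// (lt_trans l10).
  have /ltW h' := powR_cross_lt b10 X0 X1 Y0 Y1 h.
  rewrite /log_kernel !mul1r mulrCA ler_pM2l; last exact: expR_gt0.
  rewrite /r mulrAC ler_pdivlMr; last exact: powR_gt0.
  by rewrite [leRHS]mulrC; exact: h'.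
have kC v : - l1 < v -> v < 0 -> r * log_kernel 1 a0 b v <= log_kernel 1 a1 b v.
  move=> lv v0; have vl : - v < l1 by rewrite ltrNl.
  have nv0 : 0 < - v by rewrite oppr_gt0.
  have := one_sub_expR_ratio_lt nv0 vl a00 a01; rewrite opprK => h.
  have Y0 : 0 < 1 - expR (v / a0) by rewrite -(opprK v) one_sub_expR_gt0.
  have Y1 : 0 < 1 - expR (v / a1) by rewrite -(opprK v) one_sub_expR_gt0.
  have /ltW h' := powR_cross_lt b10 Y0 Y1 X0 X1 h.
  rewrite /log_kernel !mul1r mulrCA ler_pM2l; last exact: expR_gt0.
  rewrite /r mulrAC ler_pdivrMr; last exact: powR_gt0.
  by rewrite [leRHS]mulrC; exact: h'.
clearbody r; clear X X0 X1.
have A10 : \int[mu]_(s in `]-oo, - l1[) log_kernel 1 a1 b s <=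
    r * \int[mu]_(s in `]-oo, - l1[) log_kernel 1 a0 b s.
  rewrite -(RintegralZl _ _ i0); last exact: measurable_itv.
  apply: le_Rintegral; [exact: measurable_itv|exact: i1| |].
    by apply: integrable_EFinZl i0; exact: measurable_itv.
  by move=> v; rewrite /= in_itv/=; exact: kA.
have C01 : r * \int[mu]_(s in `](- l1), 0[) log_kernel 1 a0 b s <=
    \int[mu]_(s in `](- l1), 0[) log_kernel 1 a1 b s.
  rewrite -(RintegralZl _ _ j0); last exact: measurable_itv.
  apply: le_Rintegral; [exact: measurable_itv| |exact: j1|].
    by apply: integrable_EFinZl j0; exact: measurable_itv.
  by move=> v; rewrite /= in_itv/= => /andP[]; exact: kC.
exact: (odds_contradiction p0 p1 r0 a00 a10 e1 lt0 A10 C01).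
Qed.

(** * The logarithmic derivative of the quantile as a first moment *)

(** The density in the coordinate centred at [z], normalized to have value [1]
at the centre [s = 0]. *)
Definition log_kernel_ratio (R : realType) (z a b s : R) : R :=
  (1 - z) `^ (1 - b) * log_kernel z a b s.

Definition log_moment (R : realType) (p z a b l : R) : R :=
  p * \int[mu]_(v in `]0, l[) (v * log_kernel_ratio z a b v) +
  (1 - p) * \int[mu]_(v in `]-oo, 0[) (- v * log_kernel_ratio z a b v).

Lemma integrable_ln_beta_kernelS (R : realType) (a b : R) (D : set R) :
  0 < a -> 0 < b -> measurable D -> D `<=` `]0, 1[ ->
  mu.-integrable D (EFin \o (fun t => - ln t * beta_kernel a b t)).
Proof. by move=> a0 b0 mD sD; apply: integrableS (integrable_ln_beta_kernel a0 b0). Qed.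

Lemma weighted_ln_ratio (R : realType) (a b z : R) (i : interval R) :
  0 < a -> 0 < b -> 0 < z -> [set` i] `<=` `]0, 1[ ->
  mu.-integrable [set` i] (EFin \o (fun t => - (a * ln (t / z)) * beta_kernel a b t)) /\
  \int[mu]_(t in [set` i]) (- (a * ln (t / z)) * beta_kernel a b t) =
  a * \int[mu]_(t in [set` i]) (- ln t * beta_kernel a b t)
  - (- (a * ln z)) * \int[mu]_(t in [set` i]) beta_kernel a b t.
Proof.
move=> a0 b0 z0 i01.
have mi := measurable_itv i.
have i1 := integrable_ln_beta_kernelS a0 b0 mi i01.
have i2 := integrable_beta_kernelS a0 b0 mi i01.
have j1 : mu.-integrable [set` i] (EFin \o (fun t => a * (- ln t * beta_kernel a b t))).
  by apply: integrable_EFinZl i1.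
have j2 : mu.-integrable [set` i] (EFin \o (fun t => - (a * ln z) * beta_kernel a b t)).
  by apply: integrable_EFinZl i2.
have e t : t \in [set` i] -> a * (- ln t * beta_kernel a b t) - - (a * ln z) * beta_kernel a b t =
    - (a * ln (t / z)) * beta_kernel a b t.
  move=> /set_mem/i01; rewrite /= in_itv/= => /andP[t0 _].
  by rewrite ln_div ?posrE//; ring.
have j3 : mu.-integrable [set` i] (EFin \o (fun t =>
    a * (- ln t * beta_kernel a b t) - - (a * ln z) * beta_kernel a b t)).
  by apply: integrable_EFinB j1 j2.
split.
  by apply: eq_integrable j3 => // t ti /=; rewrite e.
rewrite -(RintegralZl _ _ i1)// -(RintegralZl _ _ i2)// -(RintegralB _ j1 j2)//.
by apply: eq_Rintegral => t ti; rewrite e.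
Qed.

(** Replacing [ln t] by [ln (t / z)] changes the logarithmic masses by multiples
of [ln z] that cancel because [z] is the [p]-quantile. *)
Lemma log_moment_algebra (R : realType) (p a c MA MC lz Lz LU mz mU : R) :
  mz = p * (mz + mU) ->
  c * MA = a * Lz - - (a * lz) * mz ->
  - (c * MC) = a * LU - - (a * lz) * mU ->
  a * (Lz - p * (Lz + LU)) = c * (p * MC + (1 - p) * MA).
Proof.
move=> bal eA eC.
have -> : c * (p * MC + (1 - p) * MA) = (1 - p) * (c * MA) - p * (- (c * MC)) by ring.
rewrite eA eC.
have -> : (1 - p) * (a * Lz - - (a * lz) * mz) - p * (a * LU - - (a * lz) * mU) =
  a * (Lz - p * (Lz + LU)) + a * lz * (mz - p * (mz + mU)) by ring.
by rewrite -bal subrr mulr0 addr0.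
Qed.

Lemma balance_algebra (R : realType) (p c D A C mz mU : R) :
  c != 0 -> mz = c * A -> mU = c * C -> (1 - p) * mz = p * mU ->
  (1 - p) * (D * A) = p * (D * C).
Proof.
move=> c0 -> -> h; apply: (mulfI c0).
have -> : c * ((1 - p) * (D * A)) = D * ((1 - p) * (c * A)) by ring.
by rewrite h; ring.
Qed.

Lemma log_moment_normalize (R : realType) (p a z k za D MA MC L : R) :
  a != 0 -> za != 0 -> D != 0 -> z * k = za * D^-1 ->
  a * L = za / a * (p * MC + (1 - p) * MA) ->
  a ^+ 2 * (L / k) / z = p * (D * MC) + (1 - p) * (D * MA).
Proof.
move=> a0 za0 D0 zk key.
rewrite -mulrA -mulrA -invfM mulrA expr2 -[a * a * L]mulrA key (mulrC k) zk.
by field; rewrite za0 D0 a0.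
Qed.

(** The last equation identifies [a ^+ 2 * q' a / q a], in the form given by
[is_derive_quantile], with a moment centred at the quantile.  The constant
[z `^ a / a] of the change of variables is cancelled by
[z * beta_kernel a b z = z `^ a * (1 - z) `^ (b - 1)]. *)
Lemma quantile_log_moment (R : realType) (p a b l z : R) :
  0 < a -> 0 < b -> 0 < l -> z = expR (- l / a) ->
  beta_mass a b z = p * beta_mass a b 1 ->
  [/\ mu.-integrable `]-oo, 0[ (EFin \o log_kernel_ratio z a b),
      mu.-integrable `]-oo, 0[ (EFin \o (fun v => - v * log_kernel_ratio z a b v)),
      mu.-integrable `]0, l[ (EFin \o log_kernel_ratio z a b) &
      mu.-integrable `]0, l[ (EFin \o (fun v => v * log_kernel_ratio z a b v))] /\
  (1 - p) * \int[mu]_(v in `]-oo, 0[) log_kernel_ratio z a b v =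
    p * \int[mu]_(v in `]0, l[) log_kernel_ratio z a b v /\
  a ^+ 2 * ((beta_log_mass a b z - p * beta_log_mass a b 1) / beta_kernel a b z) / z =
    log_moment p z a b l.
Proof.
move=> a0 b0 l0 zE mz.
have z0 : 0 < z by rewrite zE expR_gt0.
have z1 : z < 1 by rewrite zE expR_lt1 mulNr oppr_lt0 divr_gt0.
have z01 : 0 < z < 1 by rewrite z0.
have w0 : z = z * expR (0 / a) by rewrite mul0r expR0 mulr1.
have w1 : 1 = z * expR (l / a) by rewrite zE -expRD mulNr addNr expR0.
have sub0 : `]0, z[ `<=` `]0, 1[.
  by move=> t; rewrite /= !in_itv/= => /andP[-> /lt_trans]; exact.
have sub1 : `]z, 1[ `<=` `]0, 1[.
  by move=> t; rewrite /= !in_itv/= => /andP[/(lt_trans z0)->].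
have [iA eA] := beta_kernel_subst_below z0 a0 b0 w0 (ltW z1).
have [iC eC] := beta_kernel_subst_between z0 a0 b0 l0 w0 w1 (lexx 1).
have [vA nA] := weighted_ln_ratio a0 b0 z0 sub0.
have [vC nC] := weighted_ln_ratio a0 b0 z0 sub1.
have copp : continuous (fun s : R => - s) by exact: oppr_continuous.
have cid : continuous (fun s : R => s) by move=> s; exact: cvg_id.
have npos (s : R) : s < 0 -> 0 <= - s by move=> s0; rewrite oppr_ge0 ltW.
have [jA fA] := @weighted_beta_kernel_subst_below R z a b 0 z (fun s => - s) z0 a0 w0 (ltW z1)
  npos copp vA.
have eN t : - (a * ln (t / z)) * beta_kernel a b t = - 1 * (a * ln (t / z) * beta_kernel a b t).
  by rewrite mulN1r mulNr.
have vC' : mu.-integrable `]z, 1[ (EFin \o (fun t => a * ln (t / z) * beta_kernel a b t)).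
  have h : mu.-integrable `]z, 1[ (EFin \o (fun t => - 1 * (- (a * ln (t / z)) * beta_kernel a b t))).
    by apply: integrable_EFinZl vC.
  by apply: eq_integrable h => // t _ /=; rewrite eN mulrA mulrNN !mul1r.
have ppos (s : R) : 0 < s < l -> 0 <= s by move=> /andP[/ltW].
have [jC fC] := @weighted_beta_kernel_subst_between R z a b 0 l z 1 (fun s => s) z0 a0 l0 w0 w1
    (lexx 1) ppos cid vC'.
have fC' : \int[mu]_(t in `]z, 1[) (- (a * ln (t / z)) * beta_kernel a b t) =
    - (z `^ a / a * \int[mu]_(s in `]0, l[) (s * log_kernel z a b s)).
  rewrite -fC -mulN1r -(RintegralZl _ _ vC'); last exact: measurable_itv.
  by apply: eq_Rintegral => t _; exact: eN.
pose D := (1 - z) `^ (1 - b).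
have eD v w : D * (v * w) = v * (D * w) by rewrite mulrCA.
have jA' : mu.-integrable `]-oo, 0[ (EFin \o (fun v => D * (- v * log_kernel z a b v))).
  by apply: integrable_EFinZl jA.
have jC' : mu.-integrable `]0, l[ (EFin \o (fun v => D * (v * log_kernel z a b v))).
  by apply: integrable_EFinZl jC.
split.
  split; [by apply: integrable_EFinZl iA| |by apply: integrable_EFinZl iC|].
  - by apply: eq_integrable jA' => // t _ /=; rewrite eD.
  - by apply: eq_integrable jC' => // t _ /=; rewrite eD.
have bal := beta_mass1_split a0 b0 z01.
have c0 : z `^ a / a != 0 by rewrite gt_eqF// divr_gt0// powR_gt0.
have sA : \int[mu]_(v in `]-oo, 0[) log_kernel_ratio z a b v =
    D * \int[mu]_(v in `]-oo, 0[) log_kernel z a b v.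
  by rewrite -(RintegralZl _ _ iA).
have sC : \int[mu]_(v in `]0, l[) log_kernel_ratio z a b v =
    D * \int[mu]_(v in `]0, l[) log_kernel z a b v.
  by rewrite -(RintegralZl _ _ iC).
have sMA : \int[mu]_(v in `]-oo, 0[) (- v * log_kernel_ratio z a b v) =
    D * \int[mu]_(v in `]-oo, 0[) (- v * log_kernel z a b v).
  rewrite -(RintegralZl _ _ jA); last exact: measurable_itv.
  by apply: eq_Rintegral => v _; rewrite eD.
have sMC : \int[mu]_(v in `]0, l[) (v * log_kernel_ratio z a b v) =
    D * \int[mu]_(v in `]0, l[) (v * log_kernel z a b v).
  rewrite -(RintegralZl _ _ jC); last exact: measurable_itv.
  by apply: eq_Rintegral => v _; rewrite eD.
have mzU : beta_mass a b z = p * (beta_mass a b z + \int[mu]_(t in `]z, 1[) beta_kernel a b t).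
  by rewrite -bal.
split.
  rewrite sA sC.
  have h : (1 - p) * beta_mass a b z = p * \int[mu]_(t in `]z, 1[) beta_kernel a b t.
    by rewrite mulrBl mul1r {1}mzU mulrDr addrAC subrr add0r.
  exact: balance_algebra c0 eA eC h.
have lsplit : beta_log_mass a b 1 = beta_log_mass a b z + \int[mu]_(t in `]z, 1[) (- ln t * beta_kernel a b t).
  by apply: Rintegral_itv0_split => //; exact: integrable_ln_beta_kernel.
rewrite /log_moment sMA sMC lsplit.
have := log_moment_algebra mzU (etrans (esym fA) nA) (etrans (esym fC') nC).
rewrite -/(beta_log_mass a b z) => key.
have zk : z * beta_kernel a b z = z `^ a * (1 - z) `^ (b - 1).
  by rewrite /beta_kernel mulrA mulr_powRB1// ltW.
have za0 : z `^ a != 0 by rewrite gt_eqF// powR_gt0.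
have DE : (1 - z) `^ (b - 1) = D^-1 by rewrite /D -powRN opprB.
have D0 : D != 0 by rewrite gt_eqF// powR_gt0// subr_gt0.
have an0 : a != 0 by rewrite gt_eqF.
by apply: log_moment_normalize an0 za0 D0 _ key; rewrite zk DE.
Qed.

(** * Strict decrease of the moment, and convexity *)

Lemma log_kernel_ratio_lt (R : realType) (z0 z1 a0 a1 b v : R) : b < 1 ->
  z0 < 1 -> z1 < 1 -> z0 * expR (v / a0) < 1 -> z1 * expR (v / a1) < 1 ->
  (1 - z0 * expR (v / a0)) * (1 - z1) < (1 - z1 * expR (v / a1)) * (1 - z0) ->
  log_kernel_ratio z1 a1 b v < log_kernel_ratio z0 a0 b v.
Proof.
move=> b1 z01 z11 y01 y11 h; have b10 : b - 1 < 0 by rewrite subr_lt0.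
rewrite /log_kernel_ratio /log_kernel.
have eb : 1 - b = - (b - 1) by rewrite opprB.
have X0p : 0 < 1 - z0 by rewrite subr_gt0.
have X1p : 0 < 1 - z1 by rewrite subr_gt0.
have Y0p : 0 < 1 - z0 * expR (v / a0) by rewrite subr_gt0.
have Y1p : 0 < 1 - z1 * expR (v / a1) by rewrite subr_gt0.
move: X0p X1p Y0p Y1p h; clear z01 z11 y01 y11.
move: (1 - z0) (1 - z1) (1 - z0 * expR (v / a0)) (1 - z1 * expR (v / a1)) => X0 X1 Y0 Y1.
move=> X00 X10 Y00 Y10 h; have h' := powR_cross_lt b10 X00 X10 Y00 Y10 h.
rewrite eb !(powRN _ (b - 1)) mulrCA [ltRHS]mulrCA ltr_pM2l ?expR_gt0//.
by rewrite ltr_pdivrMl ?powR_gt0// mulrCA ltr_pdivlMl ?powR_gt0// mulrC [ltRHS]mulrC.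
Qed.

(** The case [a0 < a1] of the comparison [first_moment_lt], for the two
densities centred at their respective quantiles. *)
Lemma log_moment_lt (R : realType) (p b a0 a1 l0 l1 z0 z1 : R) :
  0 < p < 1 -> 0 < b < 1 -> 0 < a0 -> a0 < a1 -> 0 < l0 -> 0 < l1 ->
  z0 = expR (- l0 / a0) -> z1 = expR (- l1 / a1) ->
  beta_mass a0 b z0 = p * beta_mass a0 b 1 -> beta_mass a1 b z1 = p * beta_mass a1 b 1 ->
  log_moment p z1 a1 b l1 < log_moment p z0 a0 b l0.
Proof.
move=> p01 b01 a00 a01 l00 l10 z0E z1E m0 m1.
have /andP[b0 b1] := b01; have a10 := lt_trans a00 a01.
have l10le : l1 <= l0.
  apply: (scaled_log_quantile_le p01 b01 a00 a01 l00 l10); first by rewrite -z0E.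
  by rewrite -z1E.
have [[iA0 vA0 iC0 vC0] [bal0 _]] := quantile_log_moment a00 b0 l00 z0E m0.
have [[iA1 vA1 iC1 vC1] [bal1 _]] := quantile_log_moment a10 b0 l10 z1E m1.
have z01 : z0 < 1 by rewrite z0E expR_lt1 mulNr oppr_lt0 divr_gt0.
have z11 : z1 < 1 by rewrite z1E expR_lt1 mulNr oppr_lt0 divr_gt0.
have e0 v : z0 * expR (v / a0) = expR ((v - l0) / a0).
  by rewrite z0E -expRD addrC mulrBl mulNr.
have e1 v : z1 * expR (v / a1) = expR ((v - l1) / a1).
  by rewrite z1E -expRD addrC mulrBl mulNr.
have lt1_0 v : v < l0 -> z0 * expR (v / a0) < 1.
  by move=> vl; rewrite e0 expR_lt1 pmulr_llt0 ?invr_gt0// subr_lt0.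
have lt1_1 v : v < l1 -> z1 * expR (v / a1) < 1.
  by move=> vl; rewrite e1 expR_lt1 pmulr_llt0 ?invr_gt0// subr_lt0.
apply: (first_moment_lt p01 l10le iA0 iA1 vA0 vA1 iC0 iC1 vC0 vC1 bal0 bal1) => //.
- move=> v v0; apply: log_kernel_ratio_lt => //; [exact/lt1_0/(lt_trans v0)|exact/lt1_1/(lt_trans v0)|].
  by rewrite e0 e1 z0E z1E; exact: below_cross_lt.
- move=> v vl1; have /andP[v0 vl] := vl1; apply/ltW/log_kernel_ratio_lt => //.
  + exact: lt1_1.
  + exact/lt1_0/(lt_le_trans vl).
  + by rewrite e0 e1 z0E z1E; exact: above_cross_lt.
- move=> v /andP[v0 vl]; apply: mulr_ge0; first exact: powR_ge0.
  by apply/ltW/log_kernel_gt0/lt1_0.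
Qed.

(** Integrability of the density makes both sides of the extended-real quantile
equation finite. *)
Lemma quantile_beta_mass (R : realType) (p a b z : R) : 0 < a -> 0 < b ->
  is_beta_quantile p a b z -> beta_mass a b z = p * beta_mass a b 1.
Proof.
move=> a0 b0 [_ e].
have fin : inc_beta a b 1 \is a fin_num.
  by apply: integrable_fin_num (integrable_beta_kernel a0 b0).
by rewrite /beta_mass /Rintegral -[LHS]/(fine (inc_beta a b z)) e fineM.
Qed.

Unset Implicit Arguments.

Theorem theorem1p4 (R : realType) (p b : R) (q : R -> R)
    (hp : 0 < p < 1) (hb : 0 < b < 1)
    (hq : forall a : R, 0 < a -> is_beta_quantile p a b (q a)) :
  strictly_convex_on `]0, +oo[ (fun a : R => - a * ln (q a)).
Proof.
have /andP[b0 b1] := hb.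
have q01 (a : R) : 0 < a -> 0 < q a < 1 by move=> /hq[].
have qp (a : R) : 0 < a -> beta_mass a b (q a) = p * beta_mass a b 1.
  by move=> a0; exact: quantile_beta_mass (hq a a0).
pose l (a : R) := - a * ln (q a).
have l0 a : 0 < a -> 0 < l a.
  by move=> a0; rewrite /l mulNr -mulrN mulr_gt0// oppr_gt0 ln_lt0// q01.
have qE a : 0 < a -> q a = expR (- l a / a).
  move=> a0; have /andP[qa0 _] := q01 _ a0.
  have -> : - l a / a = ln (q a) by rewrite /l; field; rewrite gt_eqF.
  by rewrite lnK.
pose S (a : R) := log_moment p (q a) a b (l a).
have Slt (x y : R) : 0 < x -> x < y -> S y < S x.
  move=> x0 xy; have y0 := lt_trans x0 xy.
  exact: (log_moment_lt hp hb x0 xy (l0 _ x0) (l0 _ y0) (qE _ x0) (qE _ y0)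
    (qp _ x0) (qp _ y0)).
have dlnq (a : R) : 0 < a -> is_derive a 1 (fun x => ln (q x)) (S a / a ^+ 2).
  move=> a0; have /andP[qa0 _] := q01 _ a0.
  have d1 := is_derive_quantile b0 q01 qp a0.
  have d2 := is_derive1_ln qa0.
  have := @is_derive1_comp R (@ln R) q a _ _ d2 d1.
  have [_ [_ e]] := quantile_log_moment a0 b0 (l0 _ a0) (qE _ a0) (qp _ a0).
  have -> : S a / a ^+ 2 = (q a)^-1 *
      ((beta_log_mass a b (q a) - p * beta_log_mass a b 1) / beta_kernel a b (q a)).
    rewrite /S -e; move: (_ / beta_kernel a b (q a)) => L.
    by field; rewrite !gt_eqF.
  exact: id.
(* [s * M s s + S s] is [l s], and [x |-> x * M s s + S s] is the tangent line
   of [l] at [s]. *)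
pose M (s x : R) := - ln (q x) - S s / x.
have dM (s x : R) : 0 < x -> is_derive x 1 (M s) ((S s - S x) / x ^+ 2).
  move=> x0; have d1 := dlnq _ x0.
  have xn0 : x != 0 by rewrite gt_eqF.
  have d2 : is_derive x 1 (fun y : R => y^-1) (- x ^- 2).
    have := @is_deriveV R _ x _ 1 xn0 (is_derive_id x 1).
    by rewrite /GRing.scale/= mulr1.
  apply: is_derive_eq; rewrite /GRing.scale/=; move: (S x) (S s) => u v.
  by field; rewrite xn0.
have Mmin (s x : R) : 0 < s -> 0 < x -> x != s -> M s s < M s x.
  move=> s0 x0 xs.
  have mvt (u v : R) : 0 < u -> u < v ->
      exists2 c, c \in `]u, v[ & M s v - M s u = (S s - S c) / c ^+ 2 * (v - u).
    move=> u0 uv; apply: (@MVT _ (M s) (fun c => (S s - S c) / c ^+ 2)) => //.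
    - by move=> c; rewrite in_itv/= => /andP[uc _]; apply: dM; rewrite (lt_trans u0).
    - apply: derivable_within_continuous => c; rewrite in_itv/= => /andP[uc _].
      by have [] := dM s c (lt_le_trans u0 uc).
  have [sx|xs'|e] := ltgtP s x.
  - have [c] := mvt _ _ s0 sx; rewrite in_itv/= => /andP[sc _] e.
    rewrite -subr_gt0 e !mulr_gt0 ?subr_gt0 ?Slt// invr_gt0 exprn_gt0//.
    exact: lt_trans sc.
  - have [c] := mvt _ _ x0 xs'; rewrite in_itv/= => /andP[xc cs] e.
    have c0 := lt_trans x0 xc.
    rewrite -subr_lt0 e -mulrA nmulr_rlt0 ?subr_lt0 ?Slt//.
    by rewrite mulr_gt0 ?subr_gt0// invr_gt0 exprn_gt0.
  - by rewrite e eqxx in xs.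
move=> x y t; rewrite /= !in_itv/= !andbT => x0 y0 xy /andP[t0 t1].
(* Both ends of the chord lie strictly above the tangent line at [s]. *)
set s := t * x + (1 - t) * y.
have s0 : 0 < s by rewrite addr_gt0// mulr_gt0// subr_gt0.
have lM (u : R) : 0 < u -> - u * ln (q u) = u * M s u + S s.
  by move=> u0; rewrite /M mulrBr mulrN mulNr mulrCA divff ?gt_eqF// mulr1 subrK.
have xs : x != s.
  rewrite -subr_eq0 /s.
  have -> : x - (t * x + (1 - t) * y) = (1 - t) * (x - y) by ring.
  by rewrite mulf_neq0// subr_eq0 // gt_eqF.
have ys : y != s.
  rewrite -subr_eq0 /s.
  have -> : y - (t * x + (1 - t) * y) = - (t * (x - y)) by ring.
  by rewrite oppr_eq0 mulf_neq0// ?subr_eq0 // gt_eqF.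
have Mx := Mmin _ _ s0 x0 xs; have My := Mmin _ _ s0 y0 ys.
rewrite !lM//.
have hx : t * (x * M s s) < t * (x * M s x) by rewrite !ltr_pM2l.
have hy : (1 - t) * (y * M s s) < (1 - t) * (y * M s y) by rewrite !ltr_pM2l ?subr_gt0.
have -> : s * M s s + S s = t * (x * M s s) + (1 - t) * (y * M s s) + S s.
  by rewrite {1}/s; ring.
have -> : t * (x * M s x + S s) + (1 - t) * (y * M s y + S s) =
  t * (x * M s x) + (1 - t) * (y * M s y) + S s by ring.
by rewrite ltrD2r ltrD.
Qed.
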